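(* Consider the one-dimensional pursuit-evasion game with computable initial positions $0<x_0<y_0$. For every pair of computable sequences $(u_n)_{n\in\mathbb N}$ and $(v_n)_{n\in\mathbb N}$ of strategies for Pursuer and Evader respectively, the set $$E=\{n\in\mathbb N : \text{Evader wins playing } v_n \text{ against Pursuer playing } u_n\}$$ is $\Pi^0_2$. Moreover, there is a pair of computable sequences $(u_n)_{n\in\mathbb N}$, $(v_n)_{n\in\mathbb N}$ of strategies for which $E$ is $\Pi^0_2$-complete.
   Context: In the one-dimensional game two players, Pursuer and Evader, move on the real line $\mathbb R$. Strategies are (open-loop) control functions of time $u,v:[0,\infty)\to\mathbb R$. If Pursuer plays $u$ and Evader plays $v$, their positions at time $t\ge 0$ are $x(t)=x_0+\int_0^t u(s)\,ds$ and $y(t)=y_0+\int_0^t v(s)\,ds$. Pursuer catches Evader if there is a time $t$ with $x(t)=y(t)$; Evader wins playing $v$ against $u$ if $x(t)\neq y(t)$ for all $t\ge 0$. A function $\phi:\mathbb N\to\mathbb Q$ represents $x\in\mathbb R$ if $|x-\phi(k)|\le 2^{-k}$ for all $k$; $x$ is computable if it has a computable representation. A real function is computable if some oracle Turing machine, given any representation of a point $x$ of its domain as oracle, outputs on input $k$ a rational within $2^{-k}$ of the value at $x$. A sequence of functions $(f_n)_{n\in\mathbb N}$ is computable if $f_n$ is computable uniformly in $n$, i.e. by a single oracle machine taking $n$ as additional input. $\Pi^0_2$ refers to the arithmetical hierarchy and completeness is with respect to many-one reductions. *)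

(* Defs.v *)
(* The reals are Stdlib's R, with Coquelicot's integral; MathComp's finite types
   are used only for Turing machines. *)
From Stdlib Require Import Reals QArith Qreals Cantor.
From mathcomp Require Import all_boot.
From Coquelicot Require Import Coquelicot.

Set Implicit Arguments.
Unset Strict Implicit.
Unset Printing Implicit Defensive.

(* MathComp uses the key R for its ring scope. *)
Delimit Scope R_scope with R.

(* A two-way infinite tape over {blank, 1} (blank = false, 1 = true):
   [tape_right] starts with the scanned cell, [tape_left] lists the cells to its
   left, nearest first, and all the cells that are not listed are blank. *)
Record tape : Type := Tape { tape_left : seq bool; tape_right : seq bool }.

Inductive direction : Set := MoveLeft | Stay | MoveRight.

Definition scanned (T : tape) : bool := head false (tape_right T).

Definition write_move (T : tape) (a : bool * direction) : tape :=
  let: Tape l r := T in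
  let r' := a.1 :: behead r in
  match a.2 with
  | MoveLeft => Tape (behead l) (head false l :: r')
  | Stay => Tape l r'
  | MoveRight => Tape (a.1 :: l) (behead r)
  end.

(* Numbers are written in unary, and read off as the number of 1s on the tape. *)
Definition unary (n : nat) : tape := Tape [::] (nseq n true).

Definition tape_val (T : tape) : nat :=
  count_mem true (tape_left T) + count_mem true (tape_right T).

(* Multitape oracle Turing machines: tape 0 is the output tape, tape 1 the query
   tape, and the remaining [extra] tapes are input and work tapes. *)
Record machine : Type := Machine {
  state : finType;
  extra : nat;
  start : state;
  halting : pred state;
  querying : pred state;
  delta : state -> {ffun 'I_extra.+2 -> bool} ->
          state * {ffun 'I_extra.+2 -> bool * direction}
}.

Definition config (M : machine) : Type :=
  (state M * {ffun 'I_(extra M).+2 -> tape})%type.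

(* The i-th argument is on tape i + 2; tapes beyond the arguments are blank,
   and a machine with too few tapes ignores the last arguments. *)
Definition init (M : machine) (args : seq nat) : config M :=
  (start M,
   [ffun i : 'I_(extra M).+2 =>
      if (i < 2)%N then unary 0 else unary (nth 0%N args (i - 2))]).

(* In a querying state, the number k on the query tape is first replaced by the
   answer o k; the ordinary transition then follows. Halting configurations are
   fixed. *)
Definition step (M : machine) (o : nat -> nat) (c : config M) : config M :=
  let: (s, ts) := c in
  if halting s then c else
  let ts' := [ffun i : 'I_(extra M).+2 =>
    if querying s && (i == 1%N :> nat) then unary (o (tape_val (ts i)))
    else ts i] in
  let: (s', act) := delta s [ffun i => scanned (ts' i)] in
  (s', [ffun i => write_move (ts' i) (act i)]).

Definition computes (M : machine) (o : nat -> nat) (args : seq nat) (m : nat) :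
    Prop :=
  exists t : nat, let c := iter t (step o) (init M args) in
    halting c.1 /\ tape_val (c.2 ord0) = m.

(* A machine without querying states is an ordinary Turing machine; the oracle
   passed to [computes] is then irrelevant. *)
Definition oracle_free (M : machine) : Prop := forall s : state M, ~~ querying s.

Definition computable_nat (f : nat -> nat) : Prop :=
  exists2 M : machine, oracle_free M &
    forall n : nat, computes M (fun=> 0%N) [:: n] (f n).

Definition computable_rel3 (r : nat -> nat -> nat -> bool) : Prop :=
  exists2 M : machine, oracle_free M &
    forall n a b : nat, computes M (fun=> 0%N) [:: n; a; b] (nat_of_bool (r n a b)).

Definition Pi02 (A : nat -> Prop) : Prop :=
  exists2 r : nat -> nat -> nat -> bool, computable_rel3 r &
    forall n : nat, A n <-> forall a : nat, exists b : nat, r n a b.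

Definition many_one_reducible (B A : nat -> Prop) : Prop :=
  exists2 f : nat -> nat, computable_nat f & forall n : nat, B n <-> A (f n).

Definition Pi02_complete (A : nat -> Prop) : Prop :=
  Pi02 A /\ forall B : nat -> Prop, Pi02 B -> many_one_reducible B A.

(* Bijective codings of Z and of the formal fractions Q by natural numbers. *)
Definition Zcode (z : Z) : nat :=
  match z with
  | Z0 => 0%N
  | Zpos p => (Pos.to_nat p).*2
  | Zneg p => (Pos.to_nat p).*2.-1
  end.

Definition Qcode (q : Q) : nat :=
  Cantor.to_nat (Zcode (Qnum q), (Pos.to_nat (Qden q)).-1).

Definition represents (phi : nat -> Q) (x : R) : Prop :=
  forall k : nat, (Rabs (x - Q2R (phi k)) <= / 2 ^ k)%R.

Definition computable_real (x : R) : Prop :=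
  exists2 phi : nat -> Q, computable_nat (fun k => Qcode (phi k)) &
    represents phi x.

(* A sequence of real functions with common domain D; the values of the f n
   outside D are irrelevant. *)
Definition computable_seq (D : R -> Prop) (f : nat -> R -> R) : Prop :=
  exists M : machine,
    forall (n : nat) (x : R) (phi : nat -> Q), D x -> represents phi x ->
    forall k : nat, exists2 q : Q,
      computes M (fun i => Qcode (phi i)) [:: n; k] (Qcode q) &
      (Rabs (Q2R q - f n x) <= / 2 ^ k)%R.

(* A strategy is a function on [0, +oo), given by a total function on R whose
   values at negative times play no role. *)
Definition computable_strategies (u : nat -> R -> R) : Prop :=
  computable_seq (fun t => (0 <= t)%R) u.

(* Computable strategies are continuous on [0, +oo), so this integral exists. *)
Definition position (x0 : R) (u : R -> R) (t : R) : R := (x0 + RInt u 0 t)%R.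

Definition evader_wins (x0 y0 : R) (u v : R -> R) : Prop :=
  forall t : R, (0 <= t)%R -> position x0 u t <> position y0 v t.

Definition evader_win_set (x0 y0 : R) (u v : nat -> R -> R) : nat -> Prop :=
  fun n => evader_wins x0 y0 (u n) (v n).

(* Main.v *)
(* Approximations.  The machine is run with a rounded-down representation of the
   left end of a grid interval of length 2 ^ -N, refusing all queries of precision
   at least N: a halting run is then a run for every point of the interval, so that
   it bounds the strategy there.  By compactness such runs exist, on a given compact
   interval, for all large N.  Hence "the distance is positive on [0, T]" is
   semi-decidable uniformly in T: search for a grid whose Riemann sums are bounded
   away from 0 by more than the error.  As the distance is positive at time 0, Evader
   wins exactly when this holds for every T.

   Hardness.  On [a, a + 1], Pursuer goes forth and back with amplitude y0 - x0, Evader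
   with amplitude eps, where eps = 2 ^ -(s + 1) if s is the first witness of the
   Sigma_1 statement number a, and eps = 0 if there is no witness: they meet exactly
   when eps = 0, and eps is uniformly computable.  A universal machine makes this
   uniform in the Pi_2 set.

   Machines.  Primitive recursive functions relative to an oracle are compiled to
   register programs, whose registers are the tapes of a machine; machines are
   simulated by primitive recursive functions on codes. *)

Require Import Defs.
From Stdlib Require Import Reals ZArith QArith Qreals Cantor Lra Lia.
From Stdlib Require Import FunctionalExtensionality ClassicalEpsilon.
From mathcomp Require Import all_boot zify.
From Coquelicot Require Import Coquelicot.

Set Implicit Arguments.
Unset Strict Implicit.
Unset Printing Implicit Defensive.

Delimit Scope R_scope with R.
Local Open Scope nat_scope.

(** * Register programs as machines *)

(** The delicate point of the upper bound is that rounding down is discontinuous at dyadic points.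
    To the left of such a point the rounded answers tend to a second sequence, off by one unit in
    the last place, which still represents the point because a representation is allowed a
    non-strict error [2 ^ -k]. Termination near a point therefore comes from two runs, one for each
    side. A single [N] bounds the mesh, the precision of the queries and the number of steps, so
    that a run that fails to halt is cured by increasing [N] alone. The dual difficulty of the lower
    bound is that one cannot decide which interval [[a, a + 1]] contains a real time. The motions
    have the profile [16 s^2 (1 - s)^2], whose derivative vanishes at both ends: the strategies are
    then Lipschitz across the integers, and it suffices to evaluate them at a rational time nearby,
    where the polynomial velocity is computed exactly from its coefficient. *)

Inductive prog : Type :=
| Skip | Inc of nat | Ask | Seq of prog & prog | Loop of nat & prog.

Definition upd (s : nat -> nat) (r n : nat) : nat -> nat :=
  fun i => if i == r then n else s i.

(** The body of a loop may change the tested register, so [Loop] is a while loop and programs may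
    diverge; hence a relation. *)
Inductive exec (o : nat -> nat) : prog -> (nat -> nat) -> (nat -> nat) -> Prop :=
| exec_skip s : exec o Skip s s
| exec_inc r s : exec o (Inc r) s (upd s r (s r).+1)
| exec_ask s : exec o Ask s (upd s 1 (o (s 1)))
| exec_seq p q s1 s2 s3 :
    exec o p s1 s2 -> exec o q s2 s3 -> exec o (Seq p q) s1 s3
| exec_loop0 r p s : s r = 0 -> exec o (Loop r p) s s
| exec_loopS r p s1 s2 s3 n :
    s1 r = n.+1 -> exec o p (upd s1 r n) s2 -> exec o (Loop r p) s2 s3 ->
    exec o (Loop r p) s1 s3.

Fixpoint max_reg (p : prog) : nat :=
  match p with
  | Skip => 0
  | Inc r => r
  | Ask => 1
  | Seq p q => maxn (max_reg p) (max_reg q)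
  | Loop r p => maxn r (max_reg p)
  end.

Inductive instr : Type := INC of nat | DEC of nat & nat | JMP of nat | ASK.

Fixpoint code (off : nat) (p : prog) : seq instr :=
  match p with
  | Skip => [::]
  | Inc r => [:: INC r]
  | Ask => [:: ASK]
  | Seq p q => let c := code off p in c ++ code (off + size c) q
  | Loop r p =>
      let c := code off.+1 p in DEC r (off + (size c).+2) :: rcons c (JMP off)
  end.

Definition is_ask (i : instr) : bool := if i is ASK then true else false.

(** A unary number occupies the cells from the head rightwards: [DEC] erases its first 1 and moves
    right, [INC] prepends a 1. Prepending takes two transitions, a move and a write; the boolean in
    the state marks the second one. *)
Definition code_delta (C : seq instr) (k : nat) (s : 'I_(size C).+1 * bool)
    (v : {ffun 'I_k.+2 -> bool}) :
    ('I_(size C).+1 * bool) * {ffun 'I_k.+2 -> bool * direction} :=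
  let idle := [ffun i => (v i, Stay)] in
  let on (r : nat) a := [ffun i : 'I_k.+2 => if i == r :> nat then a else idle i] in
  match nth (JMP 0) C s.1 with
  | INC r => if s.2 then ((inord s.1.+1, false), on r (true, Stay))
             else ((s.1, true), on r (v (inord r), MoveLeft))
  | DEC r j => if v (inord r) then ((inord s.1.+1, false), on r (false, MoveRight))
               else ((inord j, false), idle)
  | JMP j => ((inord j, false), idle)
  | ASK => ((inord s.1.+1, false), idle)
  end.

(* With [b = false] the instruction [ASK] has no effect, so that the oracle is
   replaced by the identity. *)
Definition code_machine (b : bool) (C : seq instr) (k : nat) : machine :=
  @Machine ('I_(size C).+1 * bool)%type k (ord0, false)
    (fun s => s.1 == size C :> nat)
    (fun s => b && is_ask (nth (JMP 0) C s.1))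
    (@code_delta C k).

(** Visited blank cells stay in the lists, so a number is represented only up to blanks on both
    sides. *)
Definition holds (T : tape) (n : nat) : Prop :=
  all negb (tape_left T) /\
  exists k, tape_right T = nseq n true ++ nseq k false.

Lemma holds_unary n : holds (unary n) n.
Proof. by split=> //; exists 0; rewrite cats0. Qed.

Lemma holds_val T n : holds T n -> tape_val T = n.
Proof.
case: T => l r [/= hl [k ->]]; rewrite /tape_val /= count_cat !count_nseq /=.
suff -> : count_mem true l = 0 by lia.
by apply/eqP; rewrite -leqn0 leqNgt -has_count -all_predC; apply: sub_all hl => -[].
Qed.

Lemma holds_scanned T n : holds T n -> scanned T = (0 < n).
Proof. by case: T n => l r [|n] [/= _ [[|k] ->]]. Qed.

Lemma holds_idle T n : holds T n -> holds (write_move T (scanned T, Stay)) n.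
Proof.
case: T n => l r [|n] [/= hl [k hk]]; split=> //=; rewrite /scanned /= hk.
  by case: k {hk} => [|k]; [exists 1 | exists k.+1].
by exists k.
Qed.

Lemma holds_inc T n : holds T n ->
  holds (write_move (write_move T (scanned T, MoveLeft)) (true, Stay)) n.+1.
Proof.
case: T => l r h; have [hl' [k hk]] := holds_idle h.
case: h => /= hl _; split=> /=; last by exists k; rewrite -hk.
by case: l hl {hl' hk} => //= a l /andP [].
Qed.

Lemma holds_dec T n : holds T n.+1 -> holds (write_move T (false, MoveRight)) n.
Proof. by case: T => l r [/= hl [k ->]]; split=> //=; exists k. Qed.

Definition reach (M : machine) (o : nat -> nat) (c c' : config M) : Prop :=
  exists t, iter t (step o) c = c'.

Lemma reach_trans M o (c1 c2 c3 : config M) :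
  reach o c1 c2 -> reach o c2 c3 -> reach o c1 c3.
Proof. by move=> [t <-] [t' <-]; exists (t' + t); rewrite iterD. Qed.

Lemma reach_step M o (c : config M) : reach o c (step o c).
Proof. by exists 1. Qed.

Definition tapes_hold k (ts : {ffun 'I_k.+2 -> tape}) (s : nat -> nat) : Prop :=
  forall i, holds (ts i) (s i).

Definition pc (C : seq instr) (j : nat) : 'I_(size C).+1 * bool := (inord j, false).

Lemma code_step b C k o j (ts : {ffun 'I_k.+2 -> tape}) s
    (M := code_machine b C k) (o' := if b then o else id) :
  j < size C -> tapes_hold ts s ->
  let go j' s' := exists2 ts' : {ffun 'I_k.+2 -> tape}, tapes_hold ts' s' &
    reach o ((pc C j, ts) : config M) (pc C j', ts') in
  match nth (JMP 0) C j with
  | INC r => r <= k -> go j.+1 (upd s r (s r).+1)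
  | DEC r j' => r <= k ->
      if s r is n.+1 then go j.+1 (upd s r n) else go j' s
  | JMP j' => go j' s
  | ASK => go j.+1 (upd s 1 (o' (s 1)))
  end.
Proof.
move=> hj hts go.
have jE : nat_of_ord (inord j : 'I_(size C).+1) = j by rewrite inordK // ltnW.
have nh : (j == size C) = false by apply/negbTE; rewrite neq_ltn hj.
case hC: (nth (JMP 0) C j) => [r|r j'|j'|] => [hr|hr||].
- eexists; last first.
    apply: reach_trans (reach_step _ _) _; rewrite /step /= jE nh.
    rewrite /code_delta /= jE hC /=.
    by apply: reach_trans (reach_step _ _) _; rewrite /step /= jE nh
       /code_delta /= jE hC /=; exists 0.
  move=> i; rewrite /upd; case: (eqVneq (i : nat) r) => [ir|ne].
    do 4!rewrite ?ffunE /= ?andbF ?ir ?eqxx.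
    by rewrite -ir inord_val; exact: holds_inc.
  do 4!rewrite ?ffunE /= ?andbF ?(negbTE ne).
  by do 2!apply: holds_idle.
- have hsc : scanned (ts (inord r)) = (0 < s r).
    by rewrite (holds_scanned (hts (inord r))) inordK //; lia.
  case hs: (s r) => [|n]; (eexists; last first).
  + apply: reach_trans (reach_step _ _) _; rewrite /step /= jE nh.
    by rewrite /code_delta /= jE hC /= ?ffunE ?andbF hsc hs /=; exists 0.
  + move=> i; do 4!rewrite ?ffunE /= ?andbF; exact: holds_idle (hts i).
  + apply: reach_trans (reach_step _ _) _; rewrite /step /= jE nh.
    by rewrite /code_delta /= jE hC /= ?ffunE ?andbF hsc hs /=; exists 0.
  + move=> i; do 4!rewrite ?ffunE /= ?andbF; rewrite /upd; case: eqP => [hi|_].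
      by apply: holds_dec; rewrite -hs -hi.
    exact: holds_idle (hts i).
- eexists; last first.
    apply: reach_trans (reach_step _ _) _; rewrite /step /= jE nh.
    by rewrite /code_delta /= jE hC /=; exists 0.
  by move=> i; do 4!rewrite ?ffunE /= ?andbF; exact: holds_idle (hts i).
- eexists; last first.
    apply: reach_trans (reach_step _ _) _; rewrite /step /= jE nh.
    by rewrite /code_delta /= jE hC /=; exists 0.
  move=> i; rewrite !ffunE /=; apply: holds_idle; rewrite andbT /upd.
  case: eqP => hi; last by rewrite andbF.
  rewrite andbT /o'; case: (b) => /=; last by rewrite -[in s 1]hi.
  by rewrite (holds_val (hts i)) hi; exact: holds_unary.
Qed.

(** Jump targets are absolute, so the code of [p] is considered at its place inside a larger code.
    The induction is on the execution, because a loop is resumed after its body. *)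
Lemma code_exec b C k o p s1 s2 (M := code_machine b C k) :
  exec (if b then o else id) p s1 s2 -> max_reg p <= k ->
  forall pre post, C = pre ++ code (size pre) p ++ post ->
  forall ts : {ffun 'I_k.+2 -> tape}, tapes_hold ts s1 ->
  exists2 ts' : {ffun 'I_k.+2 -> tape}, tapes_hold ts' s2 &
    reach o ((pc C (size pre), ts) : config M)
      (pc C (size pre + size (code (size pre) p)), ts').
Proof.
have instrE (pre post : seq instr) x : C = pre ++ x :: post ->
    size pre < size C /\ nth (JMP 0) C (size pre) = x.
  by move=> ->; rewrite !size_cat /= nth_cat ltnn subnn; split=> //; lia.
elim=> {p s1 s2} /=.
- by move=> s _ pre post _ ts hts; exists ts; rewrite ?addn0 //; exists 0.
- move=> r s hr pre post /instrE [lt hC] ts hts.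
  by have := code_step b o lt hts; rewrite hC addn1; apply.
- move=> s _ pre post /instrE [lt hC] ts hts.
  by have := code_step b o lt hts; rewrite hC addn1.
- move=> p q s1 s2 s3 _ IHp _ IHq; rewrite geq_max => /andP [hp hq] pre post hC ts hts.
  rewrite -catA in hC; have [ts2 hts2 r2] := IHp hp _ _ hC _ hts.
  rewrite catA -size_cat in hC; have [ts3 hts3 r3] := IHq hq _ _ hC _ hts2.
  exists ts3 => //; apply: reach_trans r2 _.
  by move: r3; rewrite !size_cat addnA.
- move=> r p s hs; rewrite geq_max => /andP [hr _] pre post.
  move=> /[dup] hC /instrE [lt hx] ts hts.
  have := code_step b o lt hts; rewrite hx hs => /(_ hr).
  by rewrite size_rcons.
- move=> r p s1 s2 s3 n hs _ IHp _ IHl hm pre post hC ts hts.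
  have [lt hx] := instrE _ _ _ hC.
  move: (hm); rewrite geq_max => /andP [hr hp].
  have := code_step b o lt hts; rewrite hx hs => /(_ hr) [ts1 hts1 r1].
  set c := code (size pre).+1 p in hC hx *.
  have hC1 : C = rcons pre (DEC r (size pre + (size c).+2)) ++
      code (size (rcons pre (DEC r (size pre + (size c).+2)))) p ++
      (JMP (size pre) :: post).
    by rewrite size_rcons hC cat_rcons /= cat_rcons.
  have [ts2 hts2] := IHp hp _ _ hC1 _ hts1; rewrite size_rcons => r2.
  have lt2 : (size pre).+1 + size c < size C.
    by rewrite hC size_cat /= size_cat size_rcons; lia.
  have := code_step b o lt2 hts2.
  have -> : nth (JMP 0) C ((size pre).+1 + size c) = JMP (size pre).
    rewrite hC1 nth_cat size_rcons ifN; last by lia.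
    by rewrite addKn nth_cat ltnn subnn.
  move=> [ts3 hts3 r3].
  have [ts4 hts4 r4] := IHl hm _ _ hC _ hts3.
  exists ts4 => //.
  exact: reach_trans r1 (reach_trans r2 (reach_trans r3 r4)).
Qed.

Definition prog_machine (b : bool) (k : nat) (p : prog) : machine :=
  code_machine b (code 0 p) (maxn k (max_reg p)).

Lemma prog_machine_oracle_free k p : oracle_free (prog_machine false k p).
Proof. by []. Qed.

Definition args_store (args : seq nat) : nat -> nat :=
  fun i => if i < 2 then 0 else nth 0 args (i - 2).

Lemma prog_machine_computes b k p o args s :
  exec (if b then o else id) p (args_store args) s ->
  computes (prog_machine b k p) o args (s 0).
Proof.
move=> hp; have hm : max_reg p <= maxn k (max_reg p) by exact: leq_maxr.
have hC : code 0 p = [::] ++ code (size (@nil instr)) p ++ [::] by rewrite cats0.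
pose ts := (init (prog_machine b k p) args).2.
have hts : tapes_hold ts (args_store args).
  by move=> i; rewrite ffunE /args_store; case: ifP => _; exact: holds_unary.
have [ts' hts' [t ht]] := code_exec hp hm hC hts.
exists t; rewrite /init -/ts /= in ht *.
have -> : (ord0, false) = pc (code 0 p) 0 by congr (_, _); apply/val_inj; rewrite /= inordK.
by rewrite ht /= inordK // eqxx; split=> //; apply: holds_val.
Qed.

(** * Compilation of primitive recursive terms *)

(* An environment consists of an oracle and of the values of the de Bruijn
   variables, the innermost first; unbound variables are 0. *)
Definition env : Type := ((nat -> nat) * seq nat)%type.

Definition ask (e : env) (k : nat) : nat := e.1 k.
Definition var (i : nat) (e : env) : nat := nth 0 e.2 i.
Definition push (x : nat) (e : env) : env := (e.1, x :: e.2).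
Definition shift (k : nat) (e : env) : env := (e.1, drop k e.2).

Inductive term : Type :=
| TVar of nat
| TZero
| TSucc of term
| TRec of term & term & term
| TLet of nat & term & term
| TShift of nat & term
| TAsk of term.

Fixpoint eval (t : term) (e : env) : nat :=
  match t with
  | TVar i => var i e
  | TZero => 0
  | TSucc t => (eval t e).+1
  | TRec n z s =>
      iteri (eval n e) (fun k acc => eval s (push k (push acc e))) (eval z e)
  | TLet k a b => eval b (push (eval a e) (shift k e))
  | TShift k t => eval t (shift k e)
  | TAsk t => ask e (eval t e)
  end.

Definition clear (r : nat) : prog := Loop r Skip.
Definition move (a b : nat) : prog := Loop a (Inc b).
Definition copy (a b tmp : nat) : prog :=
  Seq (Loop a (Seq (Inc b) (Inc tmp))) (move tmp a).

(* The value of the term is added to register [f]; the variables are held in the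
   registers [rho], and the registers from [f] on are free. *)
Fixpoint compile (rho : seq nat) (f : nat) (t : term) : prog :=
  match t with
  | TVar i => if i < size rho then copy (nth 0 rho i) f f.+1 else Skip
  | TZero => Skip
  | TSucc t => Seq (compile rho f t) (Inc f)
  | TRec n z s =>
      Seq (compile rho f z) (Seq (compile rho f.+1 n)
        (Seq (Loop f.+1 (Seq (compile (f.+2 :: f :: rho) f.+3 s)
                          (Seq (clear f) (Seq (move f.+3 f) (Inc f.+2)))))
          (clear f.+2)))
  | TLet k a b =>
      Seq (compile rho f a)
        (Seq (compile (f :: drop k rho) f.+1 b) (Seq (clear f) (move f.+1 f)))
  | TShift k t => compile (drop k rho) f t
  | TAsk t => Seq (compile rho f t) (Seq (move f 1) (Seq Ask (move 1 f)))
  end.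

Lemma exec_to o p s s1 s2 : exec o p s s1 -> s1 =1 s2 -> exec o p s s2.
Proof. by move=> h /functional_extensionality <-. Qed.

Ltac upd_cases :=
  rewrite /upd /=;
  repeat match goal with |- context [?a == ?b] => case: (@eqP _ a b) => ? //= end;
  intros; subst; try lia.

Ltac store_eq := let i := fresh "i" in move=> i; upd_cases.

Lemma exec_clear o r s : exec o (clear r) s (upd s r 0).
Proof.
move hn: (s r) => n; elim: n s hn => [|n IH] s hn.
  by apply: exec_to (exec_loop0 _ _ hn) _; store_eq.
apply: exec_loopS hn (exec_skip _ _) _.
by apply: exec_to (IH _ _) _; [rewrite /upd eqxx | store_eq].
Qed.

Lemma exec_move o a b s : a != b ->
  exec o (move a b) s (upd (upd s b (s b + s a)) a 0).
Proof.
move=> ab; move hn: (s a) => n; elim: n s hn => [|n IH] s hn.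
  by apply: exec_to (exec_loop0 _ _ hn) _; store_eq.
apply: exec_loopS hn (exec_inc _ _ _) _.
have ba : (b == a) = false by apply/negbTE; rewrite eq_sym.
by apply: exec_to (IH _ _) _; [rewrite /upd (negbTE ab) eqxx | store_eq].
Qed.

Lemma exec_copy o a b tmp s : a != b -> a != tmp -> b != tmp -> s tmp = 0 ->
  exec o (copy a b tmp) s (upd s b (s b + s a)).
Proof.
move=> ab at_ bt s0.
have h : exec o (Loop a (Seq (Inc b) (Inc tmp))) s
    (upd (upd (upd s b (s b + s a)) tmp (s tmp + s a)) a 0).
  move hn: (s a) => n; elim: n s hn {s0} => [|n IH] s hn.
    by apply: exec_to (exec_loop0 _ _ hn) _; store_eq.
  apply: exec_loopS hn (exec_seq (exec_inc _ _ _) (exec_inc _ _ _)) _.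
  apply: exec_to (IH _ _) _; last by store_eq.
  by rewrite /upd (negbTE ab) (negbTE at_) eqxx.
apply: exec_seq h _; apply: exec_to (exec_move _ _ _) _; first by rewrite eq_sym.
by store_eq.
Qed.

(** Register 1 is the query tape: it is empty between queries, and [bound_regs] keeps the variables
    away from it. *)
Definition free_from (f : nat) (s : nat -> nat) : Prop :=
  s 1 = 0 /\ forall r, f <= r -> s r = 0.

Definition bound_regs (f : nat) (rho : seq nat) : bool :=
  all (fun r => (r < f) && (r != 1)) rho.

Lemma map_upd f rho s n : bound_regs f rho -> map (upd s f n) rho = map s rho.
Proof.
move=> /allP hrho; apply/eq_in_map => r /hrho /andP [lt _].
by rewrite /upd; case: eqVneq lt => // ->; rewrite ltnn.
Qed.

Lemma bound_regsW f g rho : f <= g -> bound_regs f rho -> bound_regs g rho.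
Proof. by move=> fg; apply: sub_all => r /andP [h ->]; rewrite (leq_trans h). Qed.

Lemma exec_compile o t rho f s : 1 < f -> bound_regs f rho -> free_from f s ->
  exec o (compile rho f t) s (upd s f (eval t (o, map s rho))).
Proof.
elim: t rho f s =>
  [i||t IH|n IHn z IHz u IHu|k a IHa b IHb|k t IH|t IH] rho f s f1 hrho [s1 hf] /=.
- rewrite /var /=; case: ifP => hi.
    have := all_nthP 0 hrho _ hi; case/andP => lt _.
    apply: exec_to (exec_copy _ _ _ _ _) _; rewrite ?(hf f) ?(hf f.+1) //; try lia.
    by move=> j; rewrite (nth_map 0) // /upd add0n.
  rewrite nth_default ?size_map 1?leqNgt ?hi //.
  by apply: exec_to (exec_skip _ _) _ => i'; rewrite /upd; case: eqP => // ->; rewrite hf.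
- by apply: exec_to (exec_skip _ _) _ => i'; rewrite /upd; case: eqP => // ->; rewrite hf.
- apply: exec_seq (IH _ _ _ f1 hrho _) _ => //.
  by apply: exec_to (exec_inc _ _ _) _; store_eq.
- apply: exec_seq (IHz _ _ _ f1 hrho _) _ => //.
  set Z := eval z _; set N := eval n _.
  apply: exec_seq.
    apply: (IHn rho f.+1 (upd s f Z)); [lia|by apply: bound_regsW hrho|].
    by split=> [|r hr]; upd_cases; apply: hf; lia.
  rewrite map_upd // -/N.
  (* Between rounds, [f] holds the accumulator, [f.+1] the number of remaining rounds and [f.+2] the
     index of the next one; the registers from [f.+3] on are 0. *)
  pose st j m acc := upd (upd (upd s f acc) f.+1 m) f.+2 j.
  pose F := fun k acc => eval u (push k (push acc (o, [seq s i | i <- rho]))).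
  have loop m j : exec o
     (Loop f.+1 (Seq (compile (f.+2 :: f :: rho) f.+3 u)
        (Seq (clear f) (Seq (move f.+3 f) (Inc f.+2)))))
     (st j m (iteri j F Z)) (st (j + m) 0 (iteri (j + m) F Z)).
    elim: m j => [|m IHm] j.
      by apply: exec_to (exec_loop0 _ _ _) _; rewrite ?addn0 // /st; upd_cases.
    apply: exec_loopS; [|apply: exec_seq|].
    + by instantiate (1 := m); rewrite /st; upd_cases.
    + apply: IHu; first lia.
        apply/allP => r; rewrite !inE => /or3P [/eqP ->|/eqP ->|/(allP hrho)]; lia.
      by split=> [|r hr]; rewrite /st; upd_cases; apply: hf; lia.
    + apply: exec_seq (exec_clear _ _ _) (exec_seq (exec_move _ _ _) (exec_inc _ _ _)); lia.
    apply: exec_to; last by move=> i; rewrite -addSnnS.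
    move: (IHm j.+1); congr exec; apply: functional_extensionality => i.
    have -> : eval u (o, map (upd (st j m.+1 (iteri j F Z)) f.+1 m) (f.+2 :: f :: rho)) =
        iteri j.+1 F Z.
      rewrite /= /F /push /=; congr (eval u (_, _ :: _ :: _)).
      * by rewrite /st; upd_cases.
      * by rewrite /st; upd_cases.
      apply/eq_in_map => r /(allP hrho) /andP [lt _].
      by rewrite /st; upd_cases.
    rewrite /st; set A := iteri j.+1 F Z; set B := iteri j F Z.
    have := hf f.+3.
    by upd_cases.
  apply: exec_seq.
    by move: (loop N 0); congr exec; apply: functional_extensionality => i; rewrite /st;
      have := hf f.+2; upd_cases.
  apply: exec_to (exec_clear _ _ _) _ => i; rewrite add0n /st.
  have := hf f.+1; have := hf f.+2.
  by upd_cases.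
- apply: exec_seq (IHa _ _ _ f1 hrho _) _ => //.
  have hk : bound_regs f (drop k rho) by apply/allP => r /mem_drop /(allP hrho).
  rewrite (_ : shift k _ = (o, map s (drop k rho))); last by rewrite /shift map_drop.
  set A := eval a _.
  apply: exec_seq.
    apply: IHb; first lia.
      by rewrite /= (bound_regsW _ hk) //; lia.
    by split=> [|r hr]; upd_cases; apply: hf; lia.
  rewrite [map _ _]/= map_upd //; have -> : upd s f A f = A by rewrite /upd eqxx.
  rewrite -/(push _ _); set B := eval b _.
  apply: exec_seq (exec_clear _ _ _) _; apply: exec_to (exec_move _ _ _) _; first lia.
  have h1 := hf f.+1 (leqnSn f).
  by store_eq.
- have -> : shift k (o, map s rho) = (o, map s (drop k rho)) by rewrite /shift map_drop.
  apply: IH => //.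
  by apply/allP => r /mem_drop /(allP hrho).
- apply: exec_seq (IH _ _ _ f1 hrho _) _ => //.
  apply: exec_seq (exec_move _ _ _) _; first lia.
  apply: exec_seq (exec_ask _ _) _.
  apply: exec_to (exec_move _ _ _) _; first lia.
  rewrite /ask /=; have e1 : (1 == f) = false by lia.
  have hf0 := hf f (leqnn _).
  by move=> i; rewrite /upd /= e1 s1 !eqxx /= add0n; upd_cases.
Qed.

(** Register [f] holds the candidate and [f.+1] a flag, consumed at the start of each round and then
    set again. If the test in [f.+2] is positive, the flag is cleared and the loop ends; otherwise
    the candidate is incremented and the flag is restored by way of [f.+2]. *)
Definition search_loop (rho : seq nat) (f : nat) (P : term) : prog :=
  Loop f.+1 (Seq (compile (f :: rho) f.+2 P) (Seq (Inc f.+1)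
    (Seq (Loop f.+2 (Seq (clear f.+1) (clear f.+2)))
      (Seq (Loop f.+1 (Seq (Inc f) (Inc f.+2))) (move f.+2 f.+1))))).

Definition search_prog (rho : seq nat) (f : nat) (P F : term) : prog :=
  Seq (Inc f.+1) (Seq (search_loop rho f P)
    (Seq (compile (f :: rho) f.+1 F) (move f.+1 0))).

(** Induction on the distance [d] to a known witness; the loop may stop at an earlier one, whence
    the existential [T']. *)
Lemma exec_search_loop o rho f s P d T
    (st := fun T w => upd (upd s f T) f.+1 w)
    (val := fun t T => eval t (o, T :: map s rho)) :
  1 < f -> bound_regs f rho -> free_from f s -> 0 < val P (T + d) ->
  exists2 T', 0 < val P T' & exec o (search_loop rho f P) (st T 1) (st T' 0).
Proof.
move=> f1 hrho [s1 hf].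
have hP T0 w : exec o (compile (f :: rho) f.+2 P) (st T0 w)
    (upd (st T0 w) f.+2 (val P T0)).
  have -> : val P T0 = eval P (o, map (st T0 w) (f :: rho)).
    rewrite /= /val; congr (eval P (_, _ :: _)); first by rewrite /st; upd_cases.
    by rewrite /st !map_upd // (bound_regsW _ hrho).
  apply: exec_compile; first lia.
    by rewrite /= (bound_regsW _ hrho) ?andbT; lia.
  by split=> [|r hr]; rewrite /st; upd_cases; apply: hf; lia.
have f2 : s f.+2 = 0 by apply: hf; lia.
have body T0 : exec o (Seq (compile (f :: rho) f.+2 P) (Seq (Inc f.+1)
    (Seq (Loop f.+2 (Seq (clear f.+1) (clear f.+2)))
      (Seq (Loop f.+1 (Seq (Inc f) (Inc f.+2))) (move f.+2 f.+1)))))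
    (st T0 0) (if 0 < val P T0 then st T0 0 else st T0.+1 1).
  apply: exec_seq (hP _ _) (exec_seq (exec_inc _ _ _) _).
  case hv: (val P T0) => [|v] /=.
    apply: exec_seq; first by apply: exec_loop0; rewrite /st; upd_cases.
    apply: exec_seq.
      apply: exec_loopS (exec_seq (exec_inc _ _ _) (exec_inc _ _ _)) (exec_loop0 _ _ _).
        by instantiate (1 := 0); rewrite /st; upd_cases.
      by rewrite /st; upd_cases.
    by apply: exec_to (exec_move _ _ _) _; [lia | rewrite /st; store_eq].
  apply: exec_seq.
    apply: exec_loopS (exec_seq (exec_clear _ _ _) (exec_clear _ _ _)) (exec_loop0 _ _ _).
      by instantiate (1 := v); rewrite /st; upd_cases.
    by upd_cases.
  apply: exec_seq; first by apply: exec_loop0; upd_cases.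
  by apply: exec_to (exec_move _ _ _) _; [lia | rewrite /st; store_eq].
have st1 T0 : upd (st T0 1) f.+1 0 = st T0 0.
  by apply: functional_extensionality; rewrite /st; store_eq.
have st_hd T0 w : st T0 w f.+1 = w by rewrite /st; upd_cases.
elim: d T => [|d IH] T hd.
  rewrite addn0 in hd; exists T => //; have := body T; rewrite hd -st1 => hb.
  by apply: exec_loopS hb (exec_loop0 _ _ _); rewrite ?st1 st_hd.
have := body T; case: ifP => [hT|_] hb.
  by exists T => //; apply: exec_loopS (exec_loop0 _ _ _); rewrite ?st_hd // st1.
rewrite addnS -addSn in hd; have [T' hT' hl] := IH _ hd.
by exists T' => //; apply: exec_loopS hl; rewrite ?st_hd // st1.
Qed.

Lemma search_computes b (P F : term) m o args (o' := if b then o else id) :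
  size args = m -> (exists T, 0 < eval P (o', T :: args)) ->
  exists2 T, 0 < eval P (o', T :: args) &
    computes (prog_machine b 0 (search_prog (seq.iota 2 m) m.+2 P F)) o args
      (eval F (o', T :: args)).
Proof.
move=> hm [T hT]; pose s := args_store args.
have hs : map s (seq.iota 2 m) = args.
  apply: (@eq_from_nth _ 0); rewrite size_map size_iota // => i hi.
  by rewrite (nth_map 0) ?size_iota // nth_iota // /s /args_store /= addKn.
have hrho : bound_regs m.+2 (seq.iota 2 m).
  by apply/allP => r; rewrite mem_iota; lia.
have hf : free_from m.+2 s.
  split=> // r hr; rewrite /s /args_store ifN ?nth_default //; lia.
have [T' hT' hl] : exists2 T', 0 < eval P (o', T' :: args) &
    exec o' (search_loop (seq.iota 2 m) m.+2 P)
      (upd (upd s m.+2 0) m.+3 1) (upd (upd s m.+2 T') m.+3 0).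
  by have := @exec_search_loop o' (seq.iota 2 m) m.+2 s P T 0 isT hrho hf;
    rewrite hs; apply.
exists T' => //; set v := eval F _.
have hv : upd (upd (upd (upd s m.+2 T') m.+3 v) 0 v) m.+3 0 0 = v by [].
rewrite -[v]hv; apply: prog_machine_computes; rewrite -/s -/o'.
have s0 : s 0 = 0 by [].
clearbody s o'; have [s1 hf'] := hf.
apply: exec_seq (exec_inc _ _ _) _.
apply: exec_seq.
  move: hl; congr exec; apply: functional_extensionality => i.
  by have h2 := hf' m.+2; have h3 := hf' m.+3; upd_cases.
apply: exec_seq; first apply: exec_compile => //.
- by rewrite /= (bound_regsW _ hrho); lia.
- by split=> [|r hr]; upd_cases; apply: hf'; lia.
apply: exec_to (exec_move _ _ _) _ => //.
have -> : map (upd (upd s m.+2 T') m.+3 0) (m.+2 :: seq.iota 2 m) = T' :: args.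
  rewrite /= !map_upd // ?(bound_regsW _ hrho) // hs; congr (_ :: _); upd_cases.
by rewrite -/v => i; upd_cases.
Qed.

(** * Primitive recursive functions *)

(** The oracle is part of the environment, so this is primitive recursion relative to an oracle,
    uniformly in it. *)
Definition pr (F : env -> nat) : Prop := exists t, forall e, eval t e = F e.

Definition prb (B : env -> bool) : Prop := pr (fun e => nat_of_bool (B e)).

Lemma pr_ext F G : F =1 G -> pr F -> pr G.
Proof. by move=> FG [t ht]; exists t => e; rewrite ht FG. Qed.

Lemma pr_var i : pr (fun e => var i e).
Proof. by exists (TVar i). Qed.

Lemma pr_succ F : pr F -> pr (fun e => (F e).+1).
Proof. by move=> [t ht]; exists (TSucc t) => e /=; rewrite ht. Qed.

Lemma pr_cst n : pr (fun _ => n).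
Proof.
elim: n => [|n IH]; first by exists TZero.
exact: pr_succ.
Qed.

Lemma pr_ask F : pr F -> pr (fun e => ask e (F e)).
Proof. by move=> [t ht]; exists (TAsk t) => e /=; rewrite ht. Qed.

Lemma pr_shift k F : pr F -> pr (fun e => F (shift k e)).
Proof. by move=> [t ht]; exists (TShift k t) => e /=; rewrite ht. Qed.

Lemma pr_shift2 j k F : pr F -> pr (fun e => F (shift j (shift k e))).
Proof. by move=> h; apply: (pr_shift k (F := fun e => F (shift j e))); exact: pr_shift. Qed.

Lemma pr_var_shift i k h :
  pr (fun e => var (k + i) (h e)) -> pr (fun e => var i (shift k (h e))).
Proof. by apply: pr_ext => e; rewrite /var /shift /= nth_drop. Qed.

Lemma pr_let k G F : pr G -> pr F -> pr (fun e => F (push (G e) (shift k e))).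
Proof. by move=> [t ht] [u hu]; exists (TLet k t u) => e /=; rewrite hu ht. Qed.

Lemma push_shift x e : shift 1 (push x e) = e.
Proof. by case: e => o s; rewrite /shift /= drop0. Qed.

Lemma shift0 e : shift 0 e = e.
Proof. by case: e => o s; rewrite /shift drop0. Qed.

(** Under the binders the environment has two more entries, and [shift 2] recovers the outer one.
    Closure rules of this form let [prove_pr] build a term by following the syntax of the
    function. *)
Lemma pr_iteri N Z F : pr N -> pr Z ->
  pr (fun e => F (shift 2 e) (var 0 e) (var 1 e)) ->
  pr (fun e => iteri (N e) (F e) (Z e)).
Proof.
move=> [n hn] [z hz] [f hf]; exists (TRec n z f) => e /=; rewrite hn hz.
elim: (N e) => //= k ->; rewrite hf.
by case: e => o s; rewrite /shift /= drop0.
Qed.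

Definition pr1 (f : nat -> nat) : Prop := pr (fun e => f (var 0 e)).
Definition pr2 (f : nat -> nat -> nat) : Prop := pr (fun e => f (var 0 e) (var 1 e)).

Lemma pr_app1 f G : pr1 f -> pr G -> pr (fun e => f (G e)).
Proof. by move=> hf hG; apply: pr_ext (pr_let 0 hG hf) => e. Qed.

Lemma pr_app2 f G H : pr2 f -> pr G -> pr H -> pr (fun e => f (G e) (H e)).
Proof.
move=> hf hG hH; apply: pr_ext (pr_let 0 hH (pr_let 0 (pr_shift 1 hG) hf)) => e.
by rewrite /= push_shift shift0.
Qed.

Definition pr_fun (F : env -> nat -> nat) : Prop :=
  pr (fun e => F (shift 1 e) (var 0 e)).

Lemma pr_fun_app k F G : pr_fun F -> pr G -> pr (fun e => F (shift k e) (G e)).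
Proof.
move=> hF hG; apply: pr_ext (pr_let k hG hF) => e.
by rewrite push_shift.
Qed.

Lemma pr_fun_app0 F G : pr_fun F -> pr G -> pr (fun e => F e (G e)).
Proof. by move=> hF hG; apply: pr_ext (pr_fun_app 0 hF hG) => e; rewrite shift0. Qed.

Lemma pr_fun_app2 j k F G :
  pr_fun F -> pr G -> pr (fun e => F (shift j (shift k e)) (G e)).
Proof.
move=> hF hG; apply: pr_ext (pr_fun_app (k + j) hF hG) => e.
by rewrite /shift /= drop_drop addnC.
Qed.

Lemma pr_pred G : pr G -> pr (fun e => (G e).-1).
Proof.
apply: (pr_app1 (f := predn)).
apply: (pr_ext (F := fun e => iteri (var 0 e) (fun k _ => k) 0)).
  by move=> e; case: (var 0 e).
by apply: pr_iteri; [apply: pr_var | apply: pr_cst | apply: pr_var].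
Qed.

Lemma pr_add G H : pr G -> pr H -> pr (fun e => G e + H e).
Proof.
move=> hG hH.
apply: (pr_ext (F := fun e => iteri (G e) (fun _ => S) (H e))).
  by move=> e; elim: (G e) => //= n ->.
by apply: pr_iteri => //; apply: pr_succ; apply: pr_var.
Qed.

Lemma pr_sub G H : pr G -> pr H -> pr (fun e => G e - H e).
Proof.
move=> hG hH.
apply: (pr_ext (F := fun e => iteri (H e) (fun _ => predn) (G e))).
  by move=> e; elim: (H e) => /= [|n ->]; lia.
by apply: pr_iteri => //; apply: pr_pred; apply: pr_var.
Qed.

Lemma pr_sum N F : pr N -> pr (fun e => F (shift 1 e) (var 0 e)) ->
  pr (fun e => \sum_(0 <= i < N e) F e i).
Proof.
move=> hN hF.
apply: (pr_ext (F := fun e => iteri (N e) (fun k acc => acc + F e k) 0)).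
  by move=> e; elim: (N e) => [|n /= ->]; rewrite ?big_nil // big_nat_recr.
apply: pr_iteri => //; first exact: pr_cst.
by apply: pr_add; [exact: pr_var | apply: pr_fun_app (pr_var 0)].
Qed.

Lemma pr_iter N Z F : pr N -> pr Z -> pr_fun F ->
  pr (fun e => iter (N e) (F e) (Z e)).
Proof.
move=> hN hZ hF.
apply: (pr_ext (F := fun e => iteri (N e) (fun _ acc => F e acc) (Z e))).
  by move=> e; elim: (N e) => //= n ->.
apply: pr_iteri => //; exact: pr_fun_app (pr_var 1).
Qed.

Lemma pr_mul G H : pr G -> pr H -> pr (fun e => G e * H e).
Proof.
move=> hG hH.
apply: (pr_ext (F := fun e => \sum_(0 <= i < G e) H e)).
  by move=> e; rewrite sum_nat_const_nat subn0.
by apply: pr_sum => //; exact: (pr_shift 1 hH).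
Qed.

Lemma pr_exp G H : pr G -> pr H -> pr (fun e => G e ^ H e).
Proof.
move=> hG hH.
apply: (pr_ext (F := fun e => iteri (H e) (fun _ acc => G e * acc) 1)).
  by move=> e; elim: (H e) => //= n ->; rewrite expnS.
apply: pr_iteri => //; first exact: pr_cst.
by apply: pr_mul; [exact: (pr_shift 2 hG) | exact: pr_var].
Qed.

Lemma pr_nat_of_bool B : prb B -> pr (fun e => nat_of_bool (B e)).
Proof. by []. Qed.

Lemma prb_ext B C : B =1 C -> prb B -> prb C.
Proof. by move=> BC; apply: pr_ext => e; rewrite BC. Qed.

Lemma prb_not B : prb B -> prb (fun e => ~~ B e).
Proof.
move=> hB; apply: (pr_ext (F := fun e => 1 - B e)); first by move=> e; case: (B e).
by apply: pr_sub => //; exact: pr_cst.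
Qed.

Lemma prb_and B C : prb B -> prb C -> prb (fun e => B e && C e).
Proof.
move=> hB hC; apply: (pr_ext (F := fun e => B e * C e)); last exact: pr_mul.
by move=> e; rewrite mulnb.
Qed.

Lemma prb_leq G H : pr G -> pr H -> prb (fun e => G e <= H e).
Proof.
move=> hG hH; apply: (pr_ext (F := fun e => 1 - (G e - H e))); first by move=> e; lia.
by apply: pr_sub; [exact: pr_cst | exact: pr_sub].
Qed.

Lemma prb_eq G H : pr G -> pr H -> prb (fun e => G e == H e).
Proof.
move=> hG hH; apply: (prb_ext (B := fun e => (G e <= H e) && (H e <= G e))).
  by move=> e; rewrite eqn_leq.
by apply: prb_and; exact: prb_leq.
Qed.

Lemma pr_if B G H : prb B -> pr G -> pr H -> pr (fun e => if B e then G e else H e).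
Proof.
move=> hB hG hH; apply: (pr_ext (F := fun e => B e * G e + (1 - B e) * H e)).
  by move=> e; case: (B e); rewrite ?mul1n ?mul0n ?addn0.
by apply: pr_add; apply: pr_mul => //; apply: pr_sub => //; exact: pr_cst.
Qed.

Lemma prb_all N B : pr N -> prb (fun e => B (shift 1 e) (var 0 e)) ->
  prb (fun e => all (B e) (seq.iota 0 (N e))).
Proof.
move=> hN hB.
apply: (prb_ext (B := fun e => \sum_(0 <= i < N e) ~~ B e i == 0)); last first.
  by apply: prb_eq; [apply: pr_sum => //; exact: prb_not | exact: pr_cst].
move=> e; rewrite /index_iota subn0; elim: (seq.iota _ _) => [|i s IH] /=.
  by rewrite big_nil.
by rewrite big_cons addn_eq0 IH; case: (B e i).
Qed.

Create HintDb pr.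

#[local] Hint Unfold pr_fun : pr.
#[local] Hint Resolve pr_iter pr_cst pr_var pr_succ pr_ask pr_var_shift pr_pred pr_add
  pr_sub pr_sum pr_mul pr_exp pr_nat_of_bool prb_not prb_and prb_leq prb_eq pr_if
  prb_all : pr.
#[local] Hint Extern 1 (pr (fun e => ?F (shift _ e))) => simple apply pr_shift : pr.
#[local] Hint Extern 1 (pr (fun e => ?F (shift _ (shift _ e)))) =>
  simple apply pr_shift2 : pr.

#[local] Hint Extern 1 (pr (fun e => ?F e _)) => apply (@pr_fun_app0 F) : pr.
#[local] Hint Extern 1 (pr (fun e => ?F (shift _ e) _)) => apply (@pr_fun_app _ F) : pr.
#[local] Hint Extern 1 (pr (fun e => ?F (shift _ (shift _ e)) _)) =>
  apply (@pr_fun_app2 _ _ F) : pr.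

Ltac prove_pr := auto 100 with pr nocore.

(** The quotient is the number of positive multiples of the divisor up to the dividend; the test
    [0 < var 1 e] gives the value 0 for a zero divisor. *)
Lemma pr_div G H : pr G -> pr H -> pr (fun e => G e %/ H e).
Proof.
apply: (pr_app2 (f := divn)).
apply: (pr_ext (F := fun e => \sum_(0 <= i < var 0 e)
    ((0 < var 1 e) && (i.+1 * var 1 e <= var 0 e)))); last by prove_pr.
move=> e; set a := var 0 e; set b := var 1 e; case: (posnP b) => [->|b0].
  by rewrite divn0 big1.
transitivity (\sum_(0 <= i < a) (i < a %/ b)).
  by apply: eq_bigr => i _; rewrite -leq_divRL.
rewrite (big_cat_nat (n := a %/ b)) ?leq_div //= [X in _ + X]big_nat_cond.
rewrite [X in _ + X]big1 => [|i /andP [/andP [hi _] _]]; last by rewrite ltnNge hi.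
rewrite addn0 big_nat_cond (eq_bigr (fun=> 1)) => [|i /andP [/andP [_ ->] _]] //.
by rewrite -big_nat_cond sum_nat_const_nat subn0 muln1.
Qed.

#[local] Hint Resolve pr_div : pr.

Lemma pr_mod G H : pr G -> pr H -> pr (fun e => G e %% H e).
Proof.
move=> hG hH; apply: (pr_ext (F := fun e => G e - G e %/ H e * H e)); last by prove_pr.
by move=> e; rewrite {1}(divn_eq (G e) (H e)) addKn.
Qed.

#[local] Hint Resolve pr_mod : pr.

(** * Cantor pairing and its projections *)

Definition npair (x y : nat) : nat := Cantor.to_nat (x, y).
Definition nfst (z : nat) : nat := (Cantor.of_nat z).1.
Definition nsnd (z : nat) : nat := (Cantor.of_nat z).2.

Lemma nfst_pair x y : nfst (npair x y) = x.
Proof. by rewrite /nfst /npair Cantor.cancel_of_to. Qed.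

Lemma nsnd_pair x y : nsnd (npair x y) = y.
Proof. by rewrite /nsnd /npair Cantor.cancel_of_to. Qed.

Lemma npair_fst_snd z : npair (nfst z) (nsnd z) = z.
Proof. by rewrite /npair /nfst /nsnd -surjective_pairing Cantor.cancel_to_of. Qed.

Lemma pr_pair G H : pr G -> pr H -> pr (fun e => npair (G e) (H e)).
Proof.
move=> hG hH; apply: (pr_ext (F := fun e =>
  H e + ((H e + G e) * (H e + G e).+1) %/ 2)); last by prove_pr.
move=> e; have := Cantor.to_nat_spec (G e) (H e); rewrite -/(npair _ _).
by set x := _ * _.+1; set z := npair _ _; lia.
Qed.

Lemma sum_pick n k F : k < n -> (forall i, i != k -> F i = 0) ->
  \sum_(0 <= i < n) F i = F k.
Proof.
move=> kn hF; rewrite (bigD1_seq k) /= ?iota_uniq ?mem_index_iota //.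
by rewrite big1 ?addn0.
Qed.

(** Both components of a code are at most the code, so the projections are bounded double sums in
    which exactly one index pair contributes. *)
Lemma unpair_sum (f : nat -> nat -> nat) z :
  \sum_(0 <= x < z.+1) \sum_(0 <= y < z.+1) (if npair x y == z then f x y else 0) =
  f (nfst z) (nsnd z).
Proof.
have := Cantor.to_nat_non_decreasing (nfst z) (nsnd z).
rewrite -/(npair _ _) npair_fst_snd => hz.
rewrite (@sum_pick _ (nfst z)); [|lia|move=> x hx]; last first.
  apply: big1 => y _; case: eqP => // hxy.
  by rewrite -hxy nfst_pair eqxx in hx.
rewrite (@sum_pick _ (nsnd z)); [|lia|move=> y hy]; last first.
  case: eqP => // hxy.
  by rewrite -hxy nsnd_pair eqxx in hy.
by rewrite npair_fst_snd eqxx.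
Qed.

#[local] Hint Resolve pr_pair : pr.

Lemma pr_fst G : pr G -> pr (fun e => nfst (G e)).
Proof.
move=> hG; apply: pr_ext (fun e => unpair_sum (fun x y => x) (G e)) _.
by prove_pr.
Qed.

Lemma pr_snd G : pr G -> pr (fun e => nsnd (G e)).
Proof.
move=> hG; apply: pr_ext (fun e => unpair_sum (fun x y => y) (G e)) _.
by prove_pr.
Qed.

#[local] Hint Resolve pr_fst pr_snd : pr.

(** * Codes of tapes, machines and configurations *)

Definition lnth (i l : nat) : nat := nfst (iter i nsnd l).

Definition lbuild (n : nat) (f : nat -> nat) : nat :=
  iteri n (fun k acc => npair (f (n - k.+1)) acc) 0.

Lemma pr_lnth G H : pr G -> pr H -> pr (fun e => lnth (G e) (H e)).
Proof. by move=> hG hH; rewrite /lnth; prove_pr. Qed.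

Lemma pr_lbuild N F : pr N -> pr_fun F -> pr (fun e => lbuild (N e) (F e)).
Proof. by move=> hN hF; apply: pr_iteri; prove_pr. Qed.

#[local] Hint Resolve pr_lnth pr_lbuild : pr.

Lemma lnth_lbuild n f i : i < n -> lnth i (lbuild n f) = f i.
Proof.
have gen m : m <= n -> forall i, i < m ->
    lnth i (iteri m (fun k acc => npair (f (n - k.+1)) acc) 0) = f (n - m + i).
  elim: m => // m IH hm [|j] hj; rewrite /lnth ?iterSr iteriS ?nsnd_pair.
    by rewrite nfst_pair addn0.
  rewrite -[nfst _]/(lnth j _) IH; [congr f|..]; lia.
by move=> hi; rewrite /lbuild gen // subnn.
Qed.

Lemma eq_lbuild n f g : (forall i, i < n -> f i = g i) -> lbuild n f = lbuild n g.
Proof.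
move=> fg; rewrite /lbuild.
suff : forall m, m <= n -> iteri m (fun k acc => npair (f (n - k.+1)) acc) 0 =
    iteri m (fun k acc => npair (g (n - k.+1)) acc) 0 by apply.
by elim=> //= m IH hm; rewrite IH ?fg //; lia.
Qed.

(** The cell nearest to the head is the lowest bit: moving the head is halving one side and doubling
    the other, and blanks at the far end leave the code unchanged. *)
Definition bits (s : seq bool) : nat := foldr (fun (b : bool) n => b + n * 2) 0 s.

Lemma bits_half s : bits s %/ 2 = bits (behead s).
Proof. case: s => [|[] s] //=; lia. Qed.

Lemma bits_odd s : bits s %% 2 = head false s.
Proof. case: s => [|[] s] //=; lia. Qed.

Lemma bits_nseq n : bits (nseq n true) = 2 ^ n - 1.
Proof. by elim: n => //= n ->; have := expn_gt0 2 n; rewrite expnS; lia. Qed.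

Definition popcount (n : nat) : nat := \sum_(0 <= i < n) (n %/ 2 ^ i) %% 2.

Lemma popcount_bits s : popcount (bits s) = count_mem true s.
Proof.
have gen m : \sum_(0 <= i < m) (bits s %/ 2 ^ i) %% 2 = count_mem true (take m s).
  elim: m s => [|m IH] s; first by rewrite big_nil take0.
  rewrite big_nat_recl // expn0 divn1 bits_odd.
  under eq_bigr do rewrite expnS divnMA bits_half.
  by rewrite IH; case: s => [|[] s] //; case: m {IH}.
rewrite /popcount gen {gen}; move: (leqnn (bits s)); move: {-1}(bits s) => m.
elim: s m => [|b s IH] [|m] //= hm; last by rewrite IH //; lia.
have : bits s <= 0 by lia.
by move=> /IH; rewrite take0 => <-; case: b hm.
Qed.

Lemma pr_popcount G : pr G -> pr (fun e => popcount (G e)).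
Proof. by move=> hG; rewrite /popcount; prove_pr. Qed.

Definition tape_code (T : tape) : nat := npair (bits (tape_left T)) (bits (tape_right T)).

Definition tape_code_val (t : nat) : nat := popcount (nfst t) + popcount (nsnd t).

Definition write_code (t a : nat) : nat :=
  let l := nfst t in
  let r := nsnd t in
  let r' := nfst a + r %/ 2 * 2 in
  if nsnd a == 0 then npair (l %/ 2) (l %% 2 + r' * 2)
  else if nsnd a == 1 then npair l r'
  else npair (nfst a + l * 2) (r %/ 2).

Definition action_code (a : bool * direction) : nat :=
  npair a.1 (match a.2 with MoveLeft => 0 | Stay => 1 | MoveRight => 2 end).

Lemma tape_code_valE T : tape_code_val (tape_code T) = tape_val T.
Proof. by rewrite /tape_code_val nfst_pair nsnd_pair !popcount_bits. Qed.

Lemma tape_code_unary n : tape_code (unary n) = npair 0 (2 ^ n - 1).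
Proof. by rewrite /tape_code bits_nseq. Qed.

Lemma write_codeE T a :
  write_code (tape_code T) (action_code a) = tape_code (write_move T a).
Proof.
case: T a => l r [b []]; rewrite /write_code /action_code /tape_code /=
  !nfst_pair !nsnd_pair /= !bits_half ?bits_odd //.
Qed.

Lemma scanned_code T : nsnd (tape_code T) %% 2 = scanned T.
Proof. by rewrite nsnd_pair bits_odd. Qed.

Lemma pr_tape_code_val G : pr G -> pr (fun e => tape_code_val (G e)).
Proof. by move=> hG; apply: pr_add; apply: pr_popcount; prove_pr. Qed.

Lemma pr_write_code G H : pr G -> pr H -> pr (fun e => write_code (G e) (H e)).
Proof. by move=> hG hH; rewrite /write_code; prove_pr. Qed.

#[local] Hint Resolve pr_tape_code_val pr_write_code : pr.

(** Applied to the scanned symbols, this is the index of a row in the transition table of a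
    state. *)
Definition mask (k : nat) (v : nat -> nat) : nat := \sum_(0 <= i < k) v i * 2 ^ i.

Definition mask_bits k (m : nat) : {ffun 'I_k -> bool} :=
  [ffun i : 'I_k => odd (m %/ 2 ^ i)].

Lemma mask_lt k (v : nat -> bool) : mask k v < 2 ^ k.
Proof.
elim: k => [|k IH]; rewrite /mask ?big_nil // big_nat_recr // expnS.
by move: IH; rewrite /mask; set S := bigop _ _ _; case: (v k) => /=; lia.
Qed.

Lemma mask_bitsE k (v : nat -> bool) :
  mask_bits k (mask k v) = [ffun i : 'I_k => v i].
Proof.
suff h : forall i, i < k -> odd (mask k v %/ 2 ^ i) = v i.
  by apply/ffunP => i; rewrite !ffunE h.
elim: k v => // k IH v i hi.
have -> : mask k.+1 v = v 0 + mask k (v \o S) * 2.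
  rewrite /mask big_nat_recl // expn0 muln1; congr (_ + _).
  by rewrite big_distrl; apply: eq_bigr => j _; rewrite expnSr mulnA.
case: i hi => [|i] hi; first by rewrite expn0 divn1 oddD oddM andbF addbF oddb.
rewrite expnS divnMA.
have -> : (v 0 + mask k (v \o S) * 2) %/ 2 = mask k (v \o S) by case: (v 0); lia.
exact: IH.
Qed.

Definition state_index (M : machine) (s : state M) : nat := enum_rank s.

Definition state_of (M : machine) (i : nat) : state M := nth (start M) (enum (state M)) i.

Lemma state_indexK M (s : state M) : state_of M (state_index s) = s.
Proof. exact: nth_enum_rank. Qed.

Lemma state_index_lt M (s : state M) : state_index s < #|state M|.
Proof. exact: ltn_ord. Qed.

Definition delta_code (M : machine) (s : state M) (m : nat) : nat :=
  let: (s', act) := delta s (mask_bits _ m) in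
  npair (state_index s') (lbuild (extra M).+2 (fun i => action_code (act (inord i)))).

Definition machine_code (M : machine) : nat :=
  npair (extra M).+2 (npair (state_index (start M)) (lbuild #|state M| (fun i =>
    let s := state_of M i in
    npair (halting s) (npair (querying s)
      (lbuild (2 ^ (extra M).+2) (delta_code s)))))).

Definition config_code (M : machine) (c : config M) : nat :=
  npair (state_index c.1) (lbuild (extra M).+2 (fun i => tape_code (c.2 (inord i)))).

Definition state_code (e c : nat) : nat := lnth (nfst c) (nsnd (nsnd e)).

Definition halts_code (e c : nat) : bool := nfst (state_code e c) == 1.

Definition output_code (c : nat) : nat := tape_code_val (lnth 0 (nsnd c)).

Definition query_code (c : nat) : nat := tape_code_val (lnth 1 (nsnd c)).

Definition asks_code (e c : nat) : bool := nfst (nsnd (state_code e c)) == 1.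

(* The partial oracle [q] answers a query [k] with [(q k).-1]; if [q k = 0], then
   the configuration is kept for ever. *)
Definition step_code (q : nat -> nat) (e c : nat) : nat :=
  let a := q (query_code c) in
  let asks := asks_code e c in
  if halts_code e c then c else
  if asks && (a == 0) then c else
  let T i := if asks && (i == 1) then npair 0 (2 ^ a.-1 - 1) else lnth i (nsnd c) in
  let row := lnth (mask (nfst e) (fun i => nsnd (T i) %% 2))
    (nsnd (nsnd (state_code e c))) in
  npair (nfst row) (lbuild (nfst e) (fun i => write_code (T i) (lnth i (nsnd row)))).

Definition init_code (e x y z : nat) : nat :=
  npair (nfst (nsnd e)) (lbuild (nfst e) (fun i =>
    npair 0 (if i == 2 then 2 ^ x - 1 else if i == 3 then 2 ^ y - 1 else
             if i == 4 then 2 ^ z - 1 else 0))).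

Lemma pr_state_code G H : pr G -> pr H -> pr (fun e => state_code (G e) (H e)).
Proof. by move=> hG hH; rewrite /state_code; prove_pr. Qed.

Lemma prb_halts_code G H : pr G -> pr H -> prb (fun e => halts_code (G e) (H e)).
Proof. by move=> hG hH; apply: prb_eq; [apply/pr_fst/pr_state_code | prove_pr]. Qed.

Lemma prb_asks_code G H : pr G -> pr H -> prb (fun e => asks_code (G e) (H e)).
Proof. by move=> hG hH; apply: prb_eq; [apply/pr_fst/pr_snd/pr_state_code | prove_pr]. Qed.

Lemma pr_output_code G : pr G -> pr (fun e => output_code (G e)).
Proof. by move=> hG; apply: pr_tape_code_val; prove_pr. Qed.

Lemma pr_query_code G : pr G -> pr (fun e => query_code (G e)).
Proof. by move=> hG; apply: pr_tape_code_val; prove_pr. Qed.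

#[local] Hint Resolve pr_state_code prb_halts_code prb_asks_code pr_output_code
  pr_query_code : pr.

Lemma pr_mask N F : pr N -> pr_fun F -> pr (fun e => mask (N e) (F e)).
Proof. by move=> hN hF; rewrite /mask; prove_pr. Qed.

#[local] Hint Resolve pr_mask : pr.

Lemma pr_step_code Q G H : pr_fun Q -> pr G -> pr H ->
  pr (fun e => step_code (Q e) (G e) (H e)).
Proof. by move=> hQ hG hH; rewrite /step_code; prove_pr. Qed.

Lemma pr_init_code G X Y Z : pr G -> pr X -> pr Y -> pr Z ->
  pr (fun e => init_code (G e) (X e) (Y e) (Z e)).
Proof. by move=> hG hX hY hZ; rewrite /init_code; prove_pr. Qed.

#[local] Hint Resolve pr_step_code pr_init_code : pr.

(** * Correctness of the simulation on codes *)

Lemma state_codeE M (c : config M) :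
  state_code (machine_code M) (config_code c) =
  npair (halting c.1) (npair (querying c.1) (lbuild (2 ^ (extra M).+2) (delta_code c.1))).
Proof.
rewrite /state_code /machine_code /config_code !nsnd_pair nfst_pair.
by rewrite lnth_lbuild ?state_index_lt //= state_indexK.
Qed.

Lemma halts_codeE M (c : config M) :
  halts_code (machine_code M) (config_code c) = halting c.1.
Proof. by rewrite /halts_code state_codeE nfst_pair; case: (halting _). Qed.

Lemma asks_codeE M (c : config M) :
  asks_code (machine_code M) (config_code c) = querying c.1.
Proof. by rewrite /asks_code state_codeE nsnd_pair nfst_pair; case: (querying _). Qed.

Lemma config_code_tape M (c : config M) (i : 'I_(extra M).+2) :
  lnth i (nsnd (config_code c)) = tape_code (c.2 i).
Proof. by rewrite nsnd_pair lnth_lbuild // inord_val. Qed.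

Lemma output_codeE M (c : config M) : output_code (config_code c) = tape_val (c.2 ord0).
Proof. by rewrite /output_code (config_code_tape c ord0) tape_code_valE. Qed.

Lemma query_codeE M (c : config M) :
  query_code (config_code c) = tape_val (c.2 (inord 1)).
Proof.
by rewrite /query_code -(tape_code_valE (c.2 _)) -config_code_tape inordK.
Qed.

Lemma step_codeE M o q (c : config M) :
  (querying c.1 -> q (query_code (config_code c)) = (o (query_code (config_code c))).+1) ->
  step_code q (machine_code M) (config_code c) = config_code (step o c).
Proof.
case: c => s ts hq; rewrite /step_code halts_codeE asks_codeE /step [(s, ts).1]/=.
case: ifP => // _.
set a := q _; have -> : querying s && (a == 0) = false.
  by move: hq; rewrite -/a /=; case: (querying s) => // ->.
pose ts' := [ffun i : 'I_(extra M).+2 =>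
  if querying s && (i == 1 :> nat) then unary (o (tape_val (ts i))) else ts i].
rewrite -/ts'; pose T i :=
  if querying s && (i == 1) then npair 0 (2 ^ a.-1 - 1)
  else lnth i (nsnd (config_code (s, ts))).
have hT (i : 'I_(extra M).+2) : T i = tape_code (ts' i).
  rewrite /T ffunE; case: ifP => [/andP [hs /eqP hi]|_]; last first.
    exact: (config_code_tape (s, ts) i).
  rewrite tape_code_unary /a hq //= query_codeE /=.
  by have -> : inord 1 = i by apply/val_inj; rewrite /= inordK.
have hm : mask (nfst (machine_code M)) (fun i => nsnd (T i) %% 2) =
    mask (extra M).+2 (fun i => scanned (ts' (inord i))).
  rewrite nfst_pair /mask; apply: eq_big_nat => i /= hi.
  by rewrite -scanned_code -hT inordK.
rewrite -/T in hm *; rewrite hm state_codeE !nsnd_pair lnth_lbuild ?mask_lt //= /delta_code.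
have -> : mask_bits (extra M).+2 (mask (extra M).+2 (fun i => scanned (ts' (inord i)))) =
    [ffun i => scanned (ts' i)].
  rewrite mask_bitsE; apply/ffunP => i; by rewrite !ffunE inord_val.
case: (delta s _) => s' act; rewrite nfst_pair nsnd_pair [in RHS]/config_code.
congr npair; rewrite nfst_pair; apply: eq_lbuild => i hi.
have := hT (inord i); rewrite inordK // /T nsnd_pair => ->.
by rewrite lnth_lbuild // write_codeE [RHS]/= [in RHS]ffunE.
Qed.

Lemma step_code_stuck M q (c : config M) :
  querying c.1 -> q (query_code (config_code c)) = 0 ->
  step_code q (machine_code M) (config_code c) = config_code c.
Proof.
by move=> hs hq; rewrite /step_code halts_codeE asks_codeE hs hq; case: ifP.
Qed.

Lemma init_codeE M args : size args <= 3 ->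
  config_code (init M args) =
  init_code (machine_code M) (nth 0 args 0) (nth 0 args 1) (nth 0 args 2).
Proof.
move=> hs; rewrite /config_code /init_code /machine_code nsnd_pair !nfst_pair.
congr npair; apply: eq_lbuild => i hi; rewrite ffunE inordK //.
have h n : nth 0 args (n + 3) = 0 by apply: nth_default; lia.
case: i hi => [|[|[|[|[|i]]]]] hi; rewrite tape_code_unary //=.
by have := h i; rewrite addn3 => ->.
Qed.

Lemma sim_sound M o q (c : config M) t :
  (forall k a, q k = a.+1 -> o k = a) ->
  let e := machine_code M in
  halts_code e (iter t (step_code q e) (config_code c)) ->
  iter t (step_code q e) (config_code c) = config_code (iter t (step o) c).
Proof.
move=> hq e; elim: t c => [|t IH] c //; rewrite !iterSr.
case hs: (querying c.1); last by rewrite (step_codeE (o := o)) ?hs //; exact: IH.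
case hk: (q (query_code (config_code c))) => [|a]; last first.
  by rewrite (step_codeE (o := o)) => [|_]; [exact: IH | rewrite (hq _ _ hk) hk].
have h := step_code_stuck hs hk; rewrite -/e in h *.
rewrite h iter_fix // halts_codeE => hh.
have hc : step o c = c by case: c hh {h hk hs IH} => s ts /= ->.
by rewrite hc iter_fix.
Qed.

(** The use principle: [t] steps ask only finitely many queries, so correct answers below some bound
    reproduce them. *)
Lemma sim_complete M o (c : config M) t :
  exists K, forall q, (forall k, k < K -> q k = (o k).+1) ->
  let e := machine_code M in
  iter t (step_code q e) (config_code c) = config_code (iter t (step o) c).
Proof.
elim: t c => [|t IH] c; first by exists 0.
have [K hK] := IH (step o c).
exists (maxn K (query_code (config_code c)).+1) => q hq e; rewrite !iterSr.
rewrite (step_codeE (o := o)); last by move=> _; apply: hq; lia.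
by apply: hK => k hk; apply: hq; lia.
Qed.

Lemma computes_halted M o args t c :
  iter t (step o) (init M args) = c -> halting c.1 ->
  forall m, computes M o args m <-> tape_val (c.2 ord0) = m.
Proof.
move=> hc hh m; split=> [[t' [/= hh' <-]]|<-]; last by exists t; rewrite /= hc.
have fixed (d : config M) k : halting d.1 -> iter k (step o) d = d.
  by move=> hd; apply: iter_fix; case: d hd => s ts /= ->.
have [le|le] := leqP t t'.
  by rewrite -(subnK le) iterD hc fixed.
by rewrite -hc -(subnK (ltnW le)) iterD fixed.
Qed.

(** * Computability, real and rational approximations *)

Lemma pr_computes F m : pr F -> exists2 M, oracle_free M &
  forall o args, size args = m -> computes M o args (F (id, args)).
Proof.
move=> [t ht].
(* A search whose test always succeeds; [TShift 1] discards the candidate. *)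
exists (prog_machine false 0 (search_prog (seq.iota 2 m) m.+2 (TSucc TZero) (TShift 1 t))).
  exact: prog_machine_oracle_free.
move=> o args hm.
have [|T _] := @search_computes false (TSucc TZero) (TShift 1 t) m o args hm.
  by exists 0.
by rewrite /= ht /shift /= drop0.
Qed.

Lemma search_machine P F m : prb P -> pr F -> exists M, forall o args,
  size args = m -> (exists T, P (o, T :: args)) ->
  exists2 T, P (o, T :: args) & computes M o args (F (o, T :: args)).
Proof.
move=> [p hp] [t ht]; exists (prog_machine true 0 (search_prog (seq.iota 2 m) m.+2 p t)).
move=> o args hm [T hT].
have [|T' hT' h] := @search_computes true p t m o args hm.
  by exists T; rewrite hp hT.
exists T'; first by move: hT'; rewrite hp; case: (P _).
by rewrite -ht.
Qed.

Lemma prb_computable_rel3 r :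
  prb (fun e => r (var 0 e) (var 1 e) (var 2 e)) -> computable_rel3 r.
Proof.
move=> /(pr_computes 3) [M hM h]; exists M => // n a b.
exact: (h _ [:: n; a; b]).
Qed.

Lemma pr_computable_nat f : pr1 f -> computable_nat f.
Proof.
move=> /(pr_computes 1) [M hM h]; exists M => // n.
exact: (h _ [:: n]).
Qed.

(** * Integer parts and dyadic rationals *)

Lemma INR_add m n : INR (m + n) = (INR m + INR n)%R.
Proof. exact: plus_INR. Qed.

Lemma INR_mul m n : INR (m * n) = (INR m * INR n)%R.
Proof. exact: mult_INR. Qed.

Lemma INR_exp2 n : INR (2 ^ n) = (2 ^ n)%R.
Proof.
elim: n => [|n IH]; first by rewrite expn0.
by rewrite expnS INR_mul IH /=.
Qed.

Lemma pow2_gt0 n : (0 < 2 ^ n)%R.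
Proof. by apply: pow_lt; lra. Qed.

Lemma INR_leq m n : m <= n -> (INR m <= INR n)%R.
Proof. by move=> /leP; exact: le_INR. Qed.

Lemma INR_ltn m n : m < n -> (INR m < INR n)%R.
Proof. by move=> /ltP; exact: lt_INR. Qed.

Lemma ltn_INR m n : (INR m < INR n)%R -> m < n.
Proof. by move=> /INR_lt /ltP. Qed.

Lemma INR_div m d : 0 < d ->
  (INR (m %/ d) <= INR m / INR d < INR (m %/ d) + 1)%R.
Proof.
move=> d0; have d0' : (0 < INR d)%R by apply: (INR_ltn d0).
have h1 : (INR (m %/ d) * INR d <= INR m)%R by rewrite -INR_mul; apply: INR_leq; lia.
have h2 : (INR m < (INR (m %/ d) + 1) * INR d)%R.
  have -> : (INR (m %/ d) + 1 = INR (m %/ d + 1))%R by rewrite INR_add.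
  by rewrite -INR_mul; apply: INR_ltn; rewrite addn1; apply: ltn_ceil.
split.
  by apply: (Rmult_le_reg_r (INR d)) => //; rewrite /Rdiv Rmult_assoc Rinv_l; lra.
by apply: (Rmult_lt_reg_r (INR d)) => //; rewrite /Rdiv Rmult_assoc Rinv_l; lra.
Qed.

Lemma floor_unique m n x :
  (INR m <= x < INR m + 1)%R -> (INR n <= x < INR n + 1)%R -> m = n.
Proof.
move=> hm hn; apply/eqP; rewrite eqn_leq -(ltnS m) -(ltnS n); apply/andP.
by split; apply: ltn_INR; rewrite S_INR; lra.
Qed.

Definition floor2 (x : R) (i : nat) : nat := Z.to_nat (up (x * 2 ^ i) - 1).

Lemma floor2P x i : (0 <= x)%R -> (INR (floor2 x i) <= x * 2 ^ i < INR (floor2 x i) + 1)%R.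
Proof.
move=> x0; have y0 : (0 <= x * 2 ^ i)%R by have := pow2_gt0 i; nra.
have [h1 h2] := archimed (x * 2 ^ i).
have hz : (0 < up (x * 2 ^ i))%Z by apply: lt_IZR; lra.
rewrite /floor2 INR_IZR_INZ Z2Nat.id; last by lia.
rewrite minus_IZR; lra.
Qed.

(** Nested integer parts collapse: the cell of [x] at level [N] determines all coarser roundings of
    [x], so the partial oracle of a cell is correct for each of its points. *)
Lemma floor2_div x i N : (0 <= x)%R -> i <= N ->
  floor2 x i = floor2 x N %/ 2 ^ (N - i).
Proof.
move=> x0 hi; have d0 : 0 < 2 ^ (N - i) by rewrite expn_gt0.
apply: (@floor_unique _ _ (x * 2 ^ i)); first exact: floor2P.
have [h1 h2] := floor2P N x0.
have [h3 h4] := INR_div (floor2 x N) d0.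
have e1 : (2 ^ N = 2 ^ i * 2 ^ (N - i))%R by rewrite -pow_add; congr pow; lia.
have p := pow2_gt0 (N - i).
split.
  apply: Rle_trans h3 _; rewrite INR_exp2.
  by apply/Rle_div_l => //; rewrite Rmult_assoc -e1.
have : floor2 x N < (floor2 x N %/ 2 ^ (N - i) + 1) * 2 ^ (N - i).
  by rewrite addn1; apply: ltn_ceil.
rewrite -[_ < _]/(_.+1 <= _) => /INR_leq; rewrite S_INR INR_mul INR_add INR_exp2 /= => h5.
apply: (Rmult_lt_reg_r (2 ^ (N - i))) => //; rewrite Rmult_assoc -e1; lra.
Qed.

Definition dyadic (z i : nat) : Q := Qmake (Z.of_nat z) (Pos.of_nat (2 ^ i)).

(** The fraction stays unreduced, since codes are those of formal fractions; this keeps its code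
    primitive recursive. *)
Definition dyadic_code (z i : nat) : nat := npair (z * 2) (2 ^ i - 1).

Lemma Qcode_dyadic z i : Qcode (dyadic z i) = dyadic_code z i.
Proof.
have h : 0 < 2 ^ i by rewrite expn_gt0.
rewrite /Qcode /dyadic_code /npair /= Nat2Pos.id; last by lia.
congr (to_nat (_, _)); last by lia.
by case: z => //= z; rewrite SuccNat2Pos.id_succ muln2.
Qed.

Lemma Q2R_dyadic z i : Q2R (dyadic z i) = (INR z / 2 ^ i)%R.
Proof.
have h : 0 < 2 ^ i by rewrite expn_gt0.
rewrite /Q2R /dyadic /= -INR_IZR_INZ; congr (_ * / _)%R.
by rewrite -[Z.pos _]positive_nat_Z Nat2Pos.id -?INR_IZR_INZ ?INR_exp2 //; lia.
Qed.

Definition q_den (c : nat) : nat := (nsnd c).+1.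
(** With [q_neg]: the integer parts of [s] times the positive and the negative part of the rational
    coded by [c], so that all sums stay in [nat]. Odd codes of numerators are the negative ones. *)
Definition q_pos (s c : nat) : nat :=
  (if nfst c %% 2 == 1 then 0 else nfst c %/ 2) * s %/ q_den c.
Definition q_neg (s c : nat) : nat :=
  (if nfst c %% 2 == 1 then (nfst c).+1 %/ 2 else 0) * s %/ q_den c.

Lemma pr_q_pos G H : pr G -> pr H -> pr (fun e => q_pos (G e) (H e)).
Proof. by move=> hG hH; rewrite /q_pos /q_den; prove_pr. Qed.

Lemma pr_q_neg G H : pr G -> pr H -> pr (fun e => q_neg (G e) (H e)).
Proof. by move=> hG hH; rewrite /q_neg /q_den; prove_pr. Qed.

#[local] Hint Resolve pr_q_pos pr_q_neg : pr.

Lemma q_pos_negE s q :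
  (Rmax (Q2R q) 0 * INR s - 1 < INR (q_pos s (Qcode q)) <= Rmax (Q2R q) 0 * INR s /\
   Rmax (- Q2R q) 0 * INR s - 1 < INR (q_neg s (Qcode q)) <= Rmax (- Q2R q) 0 * INR s)%R.
Proof.
case: q => z d; rewrite /Qcode -[to_nat _]/(npair _ _) /q_pos /q_neg /q_den.
rewrite nfst_pair nsnd_pair /Q2R /=; set D := Pos.to_nat d.
have D0 : 0 < D by rewrite /D; lia.
rewrite prednK //.
have -> : IZR (Z.pos d) = INR D by rewrite INR_IZR_INZ positive_nat_Z.
have key n : (INR n / INR D * INR s - 1 < INR (n * s %/ D) <= INR n / INR D * INR s)%R.
  have := INR_div (n * s) D0; rewrite INR_mul /Rdiv Rmult_assoc.
  by rewrite [(INR s * _)%R]Rmult_comm -Rmult_assoc; lra.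
have D0' : (0 < / INR D)%R by apply: Rinv_0_lt_compat; apply: (INR_ltn D0).
have s0 : (0 <= INR s)%R by apply: pos_INR.
have key0 : (0 * INR s - 1 < INR (0 * s %/ D) <= 0 * INR s)%R.
  by rewrite mul0n div0n /=; lra.
case: z => [|p|p] /=.
- rewrite Rmult_0_l Ropp_0 Rmax_left; last by lra.
  by split; exact: key0.
- have -> : ((Pos.to_nat p).*2 %% 2 == 1) = false by lia.
  have -> : (Pos.to_nat p).*2 %/ 2 = Pos.to_nat p by lia.
  have -> : IZR (Z.pos p) = INR (Pos.to_nat p) by rewrite INR_IZR_INZ positive_nat_Z.
  have := pos_INR (Pos.to_nat p) => hp.
  rewrite Rmax_left ?[Rmax (- _) _]Rmax_right; try nra.
  by split; [exact: key | exact: key0].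
- have -> : ((Pos.to_nat p).*2.-1 %% 2 == 1) = true by have := Pos2Nat.is_pos p; lia.
  have -> : (Pos.to_nat p).*2.-1.+1 %/ 2 = Pos.to_nat p by have := Pos2Nat.is_pos p; lia.
  have -> : IZR (Z.neg p) = (- INR (Pos.to_nat p))%R.
    by rewrite INR_IZR_INZ positive_nat_Z -opp_IZR.
  have := pos_INR (Pos.to_nat p) => hp.
  rewrite Rmax_right ?[Rmax (- _) _]Rmax_left; try nra.
  split; first exact: key0.
  by have := key (Pos.to_nat p); rewrite /Rdiv; nra.
Qed.

(** * Strategies on a grid *)

Definition run_code (q : nat -> nat) (e x y z t : nat) : nat :=
  iter t (step_code q e) (init_code e x y z).

(* The answers, for precisions below [N], of the representation by rounding down
   of a real in [[j / 2 ^ N, (j + 1) / 2 ^ N)]. *)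
Definition grid_oracle (N j k : nat) : nat :=
  if k < N then (dyadic_code (j %/ 2 ^ (N - k)) k).+1 else 0.

Definition cell_run (e n m N j : nat) : nat := run_code (grid_oracle N j) e n m 0 N.

Lemma pr_run_code Q E X Y Z T : pr_fun Q -> pr E -> pr X -> pr Y -> pr Z -> pr T ->
  pr (fun e => run_code (Q e) (E e) (X e) (Y e) (Z e) (T e)).
Proof. by move=> hQ hE hX hY hZ hT; rewrite /run_code; prove_pr. Qed.

Lemma pr_cell_run E X Y N J : pr E -> pr X -> pr Y -> pr N -> pr J ->
  pr (fun e => cell_run (E e) (X e) (Y e) (N e) (J e)).
Proof.
move=> hE hX hY hN hJ; apply: pr_run_code => //; last exact: pr_cst.
by rewrite /pr_fun /grid_oracle /dyadic_code; prove_pr.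
Qed.

#[local] Hint Resolve pr_run_code pr_cell_run : pr.

Definition round_down (x : R) (i : nat) : Q := dyadic (floor2 x i) i.

Lemma represents_dyadic a x :
  (forall i, INR (a i) <= x * 2 ^ i <= INR (a i) + 1)%R ->
  represents (fun i => dyadic (a i) i) x.
Proof.
move=> ha i; rewrite Q2R_dyadic; have p := pow2_gt0 i; have [h1 h2] := ha i.
have -> : (x - INR (a i) / 2 ^ i = (x * 2 ^ i - INR (a i)) * / 2 ^ i)%R by field; lra.
have p' := Rinv_0_lt_compat _ p.
rewrite Rabs_pos_eq; last by nra.
by rewrite -{2}[(/ 2 ^ i)%R]Rmult_1_l; apply: Rmult_le_compat_r; lra.
Qed.

Lemma represents_round_down x : (0 <= x)%R -> represents (round_down x) x.
Proof.
by move=> x0; apply: represents_dyadic => i; have := floor2P i x0; lra.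
Qed.

Definition computes_seq (M : machine) (u : nat -> R -> R) : Prop :=
  forall n x phi, (0 <= x)%R -> represents phi x -> forall k, exists2 q,
    computes M (fun i => Qcode (phi i)) [:: n; k] (Qcode q) &
    (Rabs (Q2R q - u n x) <= / 2 ^ k)%R.

(** The run depends on the cell alone, so one output serves all the points [x] of the cell. *)
Lemma cell_sound M u n m N x (e := machine_code M) (c := cell_run e n m N (floor2 x N)) :
  computes_seq M u -> (0 <= x)%R -> halts_code e c ->
  exists2 q, output_code c = Qcode q & (Rabs (Q2R q - u n x) <= / 2 ^ m)%R.
Proof.
move=> hM x0; rewrite /c /cell_run /run_code.
rewrite -[init_code _ _ _ _](@init_codeE M [:: n; m]) // => hh.
have [q hq huq] := hM n x _ x0 (represents_round_down x0) m; exists q => //.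
have hs := @sim_sound M (fun i => Qcode (round_down x i)) _ _ _ _ hh.
rewrite {}hs in hh *; last first.
  move=> k a; rewrite /grid_oracle; case: ifP => // hk [<-].
  by rewrite Qcode_dyadic -floor2_div //; lia.
rewrite halts_codeE in hh; rewrite output_codeE.
by apply/(computes_halted _ hh).
Qed.

(** One-sided convergence at [s] of the sequence of roundings: any finite part of it is constant
    close to [s]. *)
Definition eventually_rounds (s : R) (side : R -> Prop) (a : nat -> nat) : Prop :=
  forall K, exists2 d, (0 < d)%R & forall x, (0 <= x)%R -> (Rabs (x - s) < d)%R ->
    side x -> forall i, i < K -> floor2 x i = a i.

Lemma eventually_rounds_each s side a :
  (forall i, exists2 d, (0 < d)%R & forall x, (0 <= x)%R -> (Rabs (x - s) < d)%R ->
    side x -> floor2 x i = a i) ->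
  eventually_rounds s side a.
Proof.
move=> h; elim=> [|K [d d0 hd]]; first by exists 1%R => //; lra.
have [d' d0' hd'] := h K; exists (Rmin d d'); first exact: Rmin_pos.
move=> x x0 hx sx i; rewrite ltnS leq_eqVlt => /orP [/eqP ->|].
  by apply: hd' => //; apply: Rlt_le_trans hx (Rmin_r _ _).
by apply: hd => //; apply: Rlt_le_trans hx (Rmin_l _ _).
Qed.

Lemma eventually_rounds_right s : (0 <= s)%R ->
  eventually_rounds s (fun x => (s <= x)%R) (floor2 s).
Proof.
move=> s0; apply: eventually_rounds_each => i.
have [h1 h2] := floor2P i s0; have p := pow2_gt0 i.
exists ((INR (floor2 s i) + 1 - s * 2 ^ i) / 2 ^ i)%R.
  by apply: Rdiv_lt_0_compat; lra.
move=> x x0 hx sx; apply: (floor_unique (floor2P i x0)).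
rewrite Rabs_pos_eq in hx; last lra.
have := Rmult_lt_compat_r _ _ _ p hx.
rewrite /Rdiv Rmult_assoc Rinv_l; last lra.
by move=> h; split; nra.
Qed.

Lemma eventually_rounds_left s : (0 < s)%R -> exists2 a,
  represents (fun i => dyadic (a i) i) s &
  eventually_rounds s (fun x => (x < s)%R) a.
Proof.
(* [a i] is the ceiling of [s * 2 ^ i] minus 1, the left limit of the integer part. *)
move=> s0; pose a i := Z.to_nat (- up (- (s * 2 ^ i))).
have ha i : (INR (a i) < s * 2 ^ i <= INR (a i) + 1)%R.
  have p := pow2_gt0 i; have [h1 h2] := archimed (- (s * 2 ^ i)).
  have hz : (up (- (s * 2 ^ i)) < 1)%Z by apply: lt_IZR; nra.
  rewrite /a INR_IZR_INZ Z2Nat.id; last by lia.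
  rewrite opp_IZR; lra.
exists a; first by apply: represents_dyadic => i; have := ha i; lra.
apply: eventually_rounds_each => i; have [h1 h2] := ha i; have p := pow2_gt0 i.
exists ((s * 2 ^ i - INR (a i)) / 2 ^ i)%R; first by apply: Rdiv_lt_0_compat; lra.
move=> x x0 hx sx; apply: (floor_unique (floor2P i x0)).
rewrite Rabs_minus_sym Rabs_pos_eq in hx; last lra.
have := Rmult_lt_compat_r _ _ _ p hx.
rewrite /Rdiv Rmult_assoc Rinv_l; last lra.
by move=> h; split; nra.
Qed.

Lemma halts_fixed q e c : halts_code e c -> step_code q e c = c.
Proof. by rewrite /step_code => ->. Qed.

(** The run on the one-sided representation of [s] halts after finitely many queries. Cells close to
    [s] on that side give the same answers, so they repeat this very run, with the same output
    [q]. *)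
Lemma cell_local_side M u n m s side a (e := machine_code M) :
  computes_seq M u -> (0 <= s)%R ->
  represents (fun i => dyadic (a i) i) s -> eventually_rounds s side a ->
  exists d N0 q, [/\ (0 < d)%R, (Rabs (Q2R q - u n s) <= / 2 ^ m)%R &
    forall x N, (0 <= x)%R -> (Rabs (x - s) < d)%R -> side x -> N0 <= N ->
    let c := cell_run e n m N (floor2 x N) in
    halts_code e c /\ output_code c = Qcode q].
Proof.
move=> hM s0 ha hr; have [q hq huq] := hM n s _ s0 ha m.
case: (hq) => t [ht _].
set o := fun i => _ in hq ht.
have [K hK] := sim_complete o (init M [:: n; m]) t.
have [d d0 hd] := hr K.
exists d, (maxn K t), q; split=> // x N x0 hx sx hN.
rewrite /cell_run /run_code -[init_code _ _ _ _](@init_codeE M [:: n; m]) //.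
have hrun : iter t (step_code (grid_oracle N (floor2 x N)) e)
    (config_code (init M [:: n; m])) = config_code (iter t (step o) (init M [:: n; m])).
  apply: hK => k hk; rewrite /grid_oracle ifT; last by lia.
  by rewrite -floor2_div //; [rewrite (hd x) // /o Qcode_dyadic | lia].
have -> : N = (N - t) + t by lia.
have hh : halts_code e (config_code (iter t (step o) (init M [:: n; m]))).
  by rewrite halts_codeE.
rewrite iterD subnK; last by lia.
rewrite hrun iter_fix; last exact: halts_fixed.
split=> //; rewrite output_codeE.
exact/(computes_halted (erefl _) ht).
Qed.

Lemma Qcode_inj : injective Qcode.
Proof.
move=> [z d] [z' d'] /(f_equal Cantor.of_nat); rewrite /= !Cantor.cancel_of_to => -[hz hd].
have -> : d = d' by lia.
by congr Qmake; case: z z' hz {hd} => [|p|p] [|p'|p'] /= hz; try lia; f_equal; lia.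
Qed.

(** The common output [q] is within [2 ^ -m] of both [u n s] and [u n x]; hence the bound on the
    oscillation, from which continuity follows. *)
Lemma cell_local M u n m s (e := machine_code M) : computes_seq M u -> (0 <= s)%R ->
  exists2 d, (0 < d)%R & exists N0, forall x N,
    (0 <= x)%R -> (Rabs (x - s) < d)%R -> N0 <= N ->
    halts_code e (cell_run e n m N (floor2 x N)) /\
    (Rabs (u n x - u n s) <= 2 * / 2 ^ m)%R.
Proof.
move=> hM s0.
have main side a : represents (fun i => dyadic (a i) i) s ->
    eventually_rounds s side a -> exists2 d, (0 < d)%R & exists N0, forall x N,
    (0 <= x)%R -> (Rabs (x - s) < d)%R -> side x -> N0 <= N ->
    halts_code e (cell_run e n m N (floor2 x N)) /\
    (Rabs (u n x - u n s) <= 2 * / 2 ^ m)%R.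
  move=> ha hr; have [d [N0 [q [d0 hq h]]]] := cell_local_side n m hM s0 ha hr.
  exists d => //; exists N0 => x N x0 hx sx hN; have [hh hout] := h x N x0 hx sx hN.
  split=> //; have [q' hq' hx'] := cell_sound hM x0 hh.
  have -> : (u n x - u n s = (Q2R q - u n s) - (Q2R q' - u n x))%R.
    have -> : q' = q by apply: Qcode_inj; rewrite -hq' -hout.
    by ring.
  by apply: Rle_trans (Rabs_triang _ _) _; rewrite Rabs_Ropp; lra.
have [d1 d10 [N1 h1]] := main _ _ (represents_round_down s0) (eventually_rounds_right s0).
(* At [s = 0] only the right side meets the domain. *)
case: (Rle_lt_or_eq_dec 0 s s0) => [sp|s00]; last first.
  exists d1 => //; exists N1 => x N x0 hx hN; apply: h1 => //; lra.
have [a ha hr] := eventually_rounds_left sp.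
have [d2 d20 [N2 h2]] := main _ _ ha hr.
exists (Rmin d1 d2); first exact: Rmin_pos.
exists (maxn N1 N2) => x N x0 hx hN; have [sx|xs] := Rle_lt_dec s x.
  by apply: h1 => //; [apply: Rlt_le_trans hx (Rmin_l _ _) | lia].
by apply: h2 => //; [apply: Rlt_le_trans hx (Rmin_r _ _) | lia].
Qed.

Lemma computes_seq_continuous M u n x : computes_seq M u ->
  continuous (fun t => u n (Rmax 0 t)) x.
Proof.
move=> hM; apply/filterlim_locally => eps.
have [m hm] : exists m, (2 * / 2 ^ m < eps)%R.
  have h1 : (Rabs (/ 2) < 1)%R by rewrite Rabs_pos_eq; lra.
  have h2 : (0 < eps / 2)%R by have := cond_pos eps; lra.
  have [m hm] := pow_lt_1_zero (/ 2) h1 _ h2.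
  exists m; have := hm m (le_n m); rewrite Rabs_pos_eq; last by apply: pow_le; lra.
  by rewrite pow_inv; lra.
have [d d0 [N0 h]] := cell_local n m hM (Rmax_l 0 x).
exists (mkposreal d d0) => y hy.
have hxy : (Rabs (Rmax 0 y - Rmax 0 x) < d)%R.
  have hy' : (Rabs (y - x) < d)%R by exact: hy.
  apply: (Rle_lt_trans _ _ _ _ hy').
  by rewrite /Rmax; case: (Rle_dec 0 y) => h1; case: (Rle_dec 0 x) => h2; split_Rabs; lra.
have [_ hu] := h _ N0 (Rmax_l 0 y) hxy (leqnn _).
rewrite /ball /= /AbsRing_ball /= /abs /minus /plus /opp /=.
exact: Rle_lt_trans hu hm.
Qed.

Lemma cell_uniform M u n m T (e := machine_code M) : computes_seq M u ->
  exists N0, forall x N, (0 <= x <= T)%R -> N0 <= N ->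
    halts_code e (cell_run e n m N (floor2 x N)).
Proof.
move=> hM.
(* The radius is shrunk so that [N0 * d <= 1]: a positive lower bound on the radii then bounds the
   thresholds [N0] as well. *)
have loc s : exists d : posreal, (0 <= s)%R -> exists N0, (INR N0 * d <= 1)%R /\
    forall x N, (0 <= x)%R -> (Rabs (x - s) < d)%R -> N0 <= N ->
    halts_code e (cell_run e n m N (floor2 x N)).
  have [s0|s0] := Rle_lt_dec 0 s; last by exists (mkposreal 1 Rlt_0_1); lra.
  have [d d0 [N0 h]] := cell_local n m hM s0.
  have N0' : (0 < INR N0 + 1)%R by have := pos_INR N0; lra.
  have N1 := Rinv_0_lt_compat _ N0'.
  exists (mkposreal _ (Rmin_pos _ _ d0 N1)) => _; exists N0; split=> /=.
    have h1 := Rmin_r d (/ (INR N0 + 1)).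
    have h2 : ((INR N0 + 1) * / (INR N0 + 1) = 1)%R by apply: Rinv_r; lra.
    have := pos_INR N0; nra.
  move=> x N x0 hx hN; apply: (h x N _ _ _).1 => //.
  by apply: Rlt_le_trans hx (Rmin_l _ _).
have [delta hdelta] := ClassicalEpsilon.choice _ loc.
(* Each [x] is within the radius of some [s] whose radius is at least [d]. This holds up to a double
   negation, which is enough because halting is a boolean. *)
have [d hd] := compactness_value_1d 0 T delta.
exists (floor2 (/ d) 0).+1 => x N hx hN.
apply/negPn/negP => hn; apply: (hd x hx) => -[s [hs [hxs hds]]].
have [N0 [hN0 h]] := hdelta s (proj1 hs).
move/negP: hn; apply; apply: (h x N) => //; first lra.
apply: ltnW; apply: leq_trans hN; apply: ltn_INR.
have d0 := cond_pos d; have := Rinv_0_lt_compat _ d0 => hi.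
have [_] := floor2P 0 (Rlt_le _ _ hi); rewrite pow_O Rmult_1_r -S_INR => h1.
apply: (Rle_lt_trans _ _ _ _ h1); apply: (Rmult_le_reg_r d) => //.
rewrite Rinv_l; last lra.
by apply: (Rle_trans _ _ _ _ hN0); apply: Rmult_le_compat_l => //; apply: pos_INR.
Qed.

(** * The distance between the players *)

Lemma free_run M q o args t (e := machine_code M) : oracle_free M -> size args <= 3 ->
  run_code q e (nth 0 args 0) (nth 0 args 1) (nth 0 args 2) t =
  config_code (iter t (step o) (init M args)).
Proof.
move=> hM hs; rewrite /run_code -init_codeE //.
elim: t => //= t ->; apply: step_codeE.
by rewrite (negbTE (hM _)).
Qed.

Lemma free_run_output M q o args m t
    (e := machine_code M)
    (c := run_code q e (nth 0 args 0) (nth 0 args 1) (nth 0 args 2) t) :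
  oracle_free M -> size args <= 3 -> computes M o args m -> halts_code e c ->
  output_code c = m.
Proof.
move=> hM hs hc; rewrite /c (free_run q o t hM hs) halts_codeE output_codeE => hh.
exact/(computes_halted (erefl _) hh).
Qed.

Lemma free_run_halts M q o args m (e := machine_code M) :
  oracle_free M -> size args <= 3 -> computes M o args m ->
  exists t0, forall t, t0 <= t ->
    halts_code e (run_code q e (nth 0 args 0) (nth 0 args 1) (nth 0 args 2) t).
Proof.
move=> hM hs [t0 [hh _]]; exists t0 => t ht.
rewrite (free_run q o t hM hs) halts_codeE -(subnK ht) iterD iter_fix //.
by move: hh; case: (iter _ _ _) => s ts /= ->.
Qed.

(** One unit of error comes from the integer parts, the other from [q]. *)
Lemma q_diff_near m q x : (Rabs (Q2R q - x) <= / 2 ^ m)%R ->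
  (Rabs (INR (q_pos (2 ^ m) (Qcode q)) - INR (q_neg (2 ^ m) (Qcode q)) - x * 2 ^ m) <= 2)%R.
Proof.
move=> hx; have [] := q_pos_negE (2 ^ m) q; rewrite INR_exp2.
have p := pow2_gt0 m.
have {}hx : (Rabs ((Q2R q - x) * 2 ^ m) <= 1)%R.
  rewrite Rabs_mult (Rabs_pos_eq (2 ^ m)); last lra.
  by apply: (Rmult_le_reg_r (/ 2 ^ m)); [exact: Rinv_0_lt_compat|]; field_simplify; lra.
move/Rabs_le_between: hx => hx h1 h2; apply/Rabs_le_between.
by move: h1 h2; rewrite /Rmax; case: Rle_dec => h3; case: Rle_dec => h4; nra.
Qed.

Lemma q_pos_near m q x : (0 <= x)%R -> (Rabs (Q2R q - x) <= / 2 ^ m)%R ->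
  (Rabs (INR (q_pos (2 ^ m) (Qcode q)) - x * 2 ^ m) <= 2)%R.
Proof.
move=> x0 hx; have [h1 _] := q_pos_negE (2 ^ m) q; rewrite INR_exp2 in h1.
have p := pow2_gt0 m.
have {}hx : (Rabs ((Q2R q - x) * 2 ^ m) <= 1)%R.
  rewrite Rabs_mult (Rabs_pos_eq (2 ^ m)); last lra.
  by apply: (Rmult_le_reg_r (/ 2 ^ m)); [exact: Rinv_0_lt_compat|]; field_simplify; lra.
move/Rabs_le_between: hx => hx; apply/Rabs_le_between.
by move: h1; rewrite /Rmax; case: Rle_dec => h3; nra.
Qed.

(** * Integrals and Riemann sums *)

Lemma ex_RInt_cont (f : R -> R) a b : (forall x, continuous f x) -> ex_RInt f a b.
Proof. by move=> hf; apply: ex_RInt_continuous => x _. Qed.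

Lemma RInt_const_error (f : R -> R) a b w E : (forall x, continuous f x) ->
  (a <= b)%R -> (forall x, (a < x < b)%R -> (Rabs (w - f x) <= E)%R) ->
  (Rabs (RInt f a b - (b - a) * w) <= E * (b - a))%R.
Proof.
move=> hf ab hw; have hI := ex_RInt_cont a b hf.
have cI (c : R) : ex_RInt (fun _ : R => c) a b.
  by apply: ex_RInt_cont => x; exact: continuous_const.
have h1 : (RInt f a b <= RInt (fun _ => w + E) a b)%R.
  apply: RInt_le => // x /hw /Rabs_le_between; lra.
have h2 : (RInt (fun _ => w - E) a b <= RInt f a b)%R.
  apply: RInt_le => // x /hw /Rabs_le_between; lra.
move: h1 h2; rewrite !RInt_const /scal /= /mult /= => h1 h2.
apply/Rabs_le_between; lra.
Qed.

Lemma riemann_error (f : R -> R) (W : nat -> R) h E L :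
  (forall x, continuous f x) -> (0 < h)%R -> W 0 = 0%R ->
  (forall j x, j < L -> (INR j * h < x < INR j.+1 * h)%R ->
    (Rabs (W j.+1 - W j - f x) <= E)%R) ->
  forall i t, i < L -> (INR i * h <= t <= INR i.+1 * h)%R ->
  (Rabs (RInt f 0 t - (h * W i + (t - INR i * h) * (W i.+1 - W i))) <= E * t)%R.
Proof.
move=> hf h0 hW0 hW.
have step i s t : i < L -> (INR i * h <= s <= t)%R -> (t <= INR i.+1 * h)%R ->
    (Rabs (RInt f 0 t - RInt f 0 s - (t - s) * (W i.+1 - W i)) <= E * (t - s))%R.
  move=> hi hs ht; rewrite -(RInt_Chasles f 0 s t) /plus /=; try exact: ex_RInt_cont.
  set A := RInt f 0 s; rewrite (_ : A + RInt f s t - A = RInt f s t)%R; last ring.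
  by apply: RInt_const_error => //; [lra | move=> x hx; apply: hW => //; lra].
have grid i : i <= L -> (Rabs (RInt f 0 (INR i * h) - h * W i) <= E * (INR i * h))%R.
  elim: i => [|i IH] hi.
    rewrite /= !Rmult_0_l RInt_point hW0 /zero /= Rmult_0_r Rminus_0_r Rabs_R0; lra.
  have := IH (ltnW hi) => /Rabs_le_between IHi.
  have hs : (INR i * h <= INR i * h <= INR i.+1 * h)%R by rewrite S_INR; lra.
  have := step i _ _ hi hs (Rle_refl _) => /Rabs_le_between; rewrite S_INR => h1.
  apply/Rabs_le_between; nra.
move=> i t hi ht; have hs : (INR i * h <= INR i * h <= t)%R by lra.
have := step i _ _ hi hs (proj2 ht) => /Rabs_le_between h1.
have := grid i (ltnW hi) => /Rabs_le_between h2.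
apply/Rabs_le_between; lra.
Qed.

(** Extending a strategy by its value at 0 makes it continuous on the whole line, so that integrals
    exist between any bounds. *)
Definition ext (u : R -> R) (t : R) : R := u (Rmax 0 t).

Definition gap (x0 y0 : R) (u v : R -> R) (t : R) : R :=
  (y0 - x0 + RInt (fun s => ext v s - ext u s) 0 t)%R.

Lemma gapE x0 y0 u v t :
  (forall x, continuous (ext u) x) -> (forall x, continuous (ext v) x) -> (0 <= t)%R ->
  gap x0 y0 u v t = (position y0 v t - position x0 u t)%R.
Proof.
move=> hu hv t0; rewrite /gap /position.
have E w : RInt w 0 t = RInt (ext w) 0 t.
  apply: RInt_ext => x; rewrite Rmin_left // => hx.
  by rewrite /ext Rmax_right //; lra.
rewrite (E u) (E v).
have -> : RInt (fun s => ext v s - ext u s)%R 0 t =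
    minus (RInt (ext v) 0 t) (RInt (ext u) 0 t).
  by rewrite -RInt_minus //; exact: ex_RInt_cont.
by rewrite /minus /plus /opp /=; ring.
Qed.

Lemma continuous_diff (u v : R -> R) :
  (forall x, continuous u x) -> (forall x, continuous v x) ->
  forall x, continuous (fun s => v s - u s)%R x.
Proof. by move=> hu hv x; apply: (continuous_minus v u). Qed.

Lemma gap_continuous x0 y0 u v :
  (forall x, continuous (ext u) x) -> (forall x, continuous (ext v) x) ->
  continuity (gap x0 y0 u v).
Proof.
move=> hu hv t; apply/continuity_pt_filterlim.
apply: (continuous_plus (fun=> y0 - x0)%R
  (fun t => RInt (fun s => ext v s - ext u s)%R 0 t)).
  exact: continuous_const.
have hd := continuous_diff hu hv.
apply: ex_derive_continuous; eexists; apply: is_derive_RInt (hd t).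
by apply: filter_forall => b; apply: RInt_correct; exact: ex_RInt_cont.
Qed.

Lemma evader_winsP x0 y0 u v : (x0 < y0)%R ->
  (forall x, continuous (ext u) x) -> (forall x, continuous (ext v) x) ->
  evader_wins x0 y0 u v <-> forall t, (0 <= t)%R -> (0 < gap x0 y0 u v t)%R.
Proof.
move=> xy hu hv; split=> h t t0; last by have := h t t0; rewrite gapE //; lra.
case: (Rlt_le_dec 0 (gap x0 y0 u v t)) => // ht.
have ne s : (0 <= s)%R -> gap x0 y0 u v s <> 0%R.
  by move=> s0; rewrite gapE //; have := h s s0; lra.
have g0 : gap x0 y0 u v 0 = (y0 - x0)%R by rewrite /gap RInt_point /zero /=; ring.
have tp : (0 < t)%R by case: t0 => // t0; move: ht; rewrite -t0 g0; lra.
have hc : continuity (fun s => - gap x0 y0 u v s)%R.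
  exact: continuity_opp (gap_continuous _ _ hu hv).
have ht' : (0 < - gap x0 y0 u v t)%R by have := ne t t0; lra.
have [|s [hs hs0]] := IVT _ _ _ hc tp _ ht'; first by rewrite g0; lra.
by case: (ne s); lra.
Qed.

(** * The upper bound *)

Definition real_run (e m N : nat) : nat := run_code (fun=> 0) e m 0 0 N.

Definition pos_sum (s : nat) (c : nat -> nat) (i : nat) : nat :=
  \sum_(0 <= j < i) q_pos s (output_code (c j)).

Definition neg_sum (s : nat) (c : nat -> nat) (i : nat) : nat :=
  \sum_(0 <= j < i) q_neg s (output_code (c j)).

(* Up to a factor [2 ^ (m + N)], the two sides of the last inequality are Riemann
   sums, with step [2 ^ -N], for the positions of the two players at [i / 2 ^ N];
   the slack [4 (T + 1) 2 ^ N] dominates all the rounding errors. *)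
Definition separated (eu ev ex ey n T m N : nat) : bool :=
  let cu := cell_run eu n m N in
  let cv := cell_run ev n m N in
  let s := 2 ^ m in
  [&& halts_code ex (real_run ex m N), halts_code ey (real_run ey m N),
      all (fun j => halts_code eu (cu j) && halts_code ev (cv j))
        (seq.iota 0 (T * 2 ^ N).+1) &
      all (fun i =>
        2 ^ N * q_pos s (output_code (real_run ex m N)) + pos_sum s cu i + neg_sum s cv i
          + 4 * T.+1 * 2 ^ N <
        2 ^ N * q_pos s (output_code (real_run ey m N)) + pos_sum s cv i + neg_sum s cu i)
        (seq.iota 0 (T * 2 ^ N).+1)].

Lemma pr_real_run E M N : pr E -> pr M -> pr N ->
  pr (fun e => real_run (E e) (M e) (N e)).
Proof. by move=> hE hM hN; apply: pr_run_code; prove_pr. Qed.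

Lemma pr_pos_sum S C I : pr S -> pr_fun C -> pr I ->
  pr (fun e => pos_sum (S e) (C e) (I e)).
Proof. by move=> hS hC hI; rewrite /pos_sum; prove_pr. Qed.

Lemma pr_neg_sum S C I : pr S -> pr_fun C -> pr I ->
  pr (fun e => neg_sum (S e) (C e) (I e)).
Proof. by move=> hS hC hI; rewrite /neg_sum; prove_pr. Qed.

#[local] Hint Resolve pr_real_run pr_pos_sum pr_neg_sum : pr.

Lemma prb_separated eu ev ex ey n T m N : pr n -> pr T -> pr m -> pr N ->
  prb (fun e => separated eu ev ex ey (n e) (T e) (m e) (N e)).
Proof.
move=> hn hT hm hN; rewrite /separated.
by prove_pr.
Qed.

Definition computes_real (M : machine) (x : R) : Prop :=
  oracle_free M /\ exists2 phi, (forall k, computes M (fun=> 0) [:: k] (Qcode (phi k))) &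
    represents phi x.

Lemma real_run_near M x m N (e := machine_code M) : computes_real M x -> (0 <= x)%R ->
  halts_code e (real_run e m N) ->
  (Rabs (INR (q_pos (2 ^ m) (output_code (real_run e m N))) - x * 2 ^ m) <= 2)%R.
Proof.
move=> [hM [phi hphi hx]] x0 hh.
rewrite (@free_run_output M (fun=> 0) (fun=> 0) [:: m] _ N hM isT (hphi m) hh).
apply: q_pos_near => //; rewrite Rabs_minus_sym; exact: hx.
Qed.

Lemma real_run_halts M x m (e := machine_code M) : computes_real M x ->
  exists N0, forall N, N0 <= N -> halts_code e (real_run e m N).
Proof.
move=> [hM [phi hphi _]].
exact: (@free_run_halts M (fun=> 0) (fun=> 0) [:: m] _ hM isT (hphi m)).
Qed.

(** The accumulated scaled velocities, Evader minus Pursuer, with the signs moved outside the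
    natural sums. *)
Definition weight (s : nat) (cu cv : nat -> nat) (i : nat) : R :=
  (INR (pos_sum s cv i) + INR (neg_sum s cu i)
   - INR (pos_sum s cu i) - INR (neg_sum s cv i))%R.

Lemma weightS s cu cv i :
  (weight s cu cv i.+1 - weight s cu cv i =
   INR (q_pos s (output_code (cv i))) - INR (q_neg s (output_code (cv i))) -
   (INR (q_pos s (output_code (cu i))) - INR (q_neg s (output_code (cu i)))))%R.
Proof.
by rewrite /weight /pos_sum /neg_sum !big_nat_recr //= !INR_add; ring.
Qed.

Definition cells_halt (eu ev n m N L : nat) : Prop :=
  forall j, j < L ->
    halts_code eu (cell_run eu n m N j) /\ halts_code ev (cell_run ev n m N j).

(** The rate 4 is 2 for the scaled velocity of each player. *)
Lemma gap_estimate Mu Mv u v x0 y0 n m N L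
    (eu := machine_code Mu) (ev := machine_code Mv)
    (W := weight (2 ^ m) (cell_run eu n m N) (cell_run ev n m N)) :
  computes_seq Mu u -> computes_seq Mv v -> cells_halt eu ev n m N L ->
  forall i t, i < L -> (INR i * / 2 ^ N <= t <= INR i.+1 * / 2 ^ N)%R ->
  (Rabs (gap x0 y0 (u n) (v n) t * 2 ^ m - ((y0 - x0) * 2 ^ m +
     (/ 2 ^ N * W i + (t - INR i * / 2 ^ N) * (W i.+1 - W i)))) <= 4 * t)%R.
Proof.
move=> hu hv hh; have p := pow2_gt0 N; have p' := Rinv_0_lt_compat _ p.
have cu : forall x, continuous (ext (u n)) x by move=> x; apply: computes_seq_continuous hu.
have cv : forall x, continuous (ext (v n)) x by move=> x; apply: computes_seq_continuous hv.
have cd := continuous_diff cu cv.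
pose f s := (2 ^ m * (ext (v n) s - ext (u n) s))%R.
have cf x : continuous f x by apply: (continuous_scal_r (2 ^ m)%R _ x (cd x)).
have hW0 : W 0 = 0%R by rewrite /W /weight /pos_sum /neg_sum !big_nil /=; ring.
have hW j x : j < L -> (INR j * / 2 ^ N < x < INR j.+1 * / 2 ^ N)%R ->
    (Rabs (W j.+1 - W j - f x) <= 4)%R.
  move=> hj [hx1 hx2]; have x0' : (0 <= x)%R by have := pos_INR j; nra.
  have e1 : (/ 2 ^ N * 2 ^ N = 1)%R by apply: Rinv_l; lra.
  have fl : floor2 x N = j.
    apply: (floor_unique (floor2P N x0')); rewrite S_INR in hx2.
    have := Rmult_lt_compat_r _ _ _ p hx1; have := Rmult_lt_compat_r _ _ _ p hx2.
    by rewrite !Rmult_assoc e1; lra.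
  have [] := hh j hj; rewrite -fl => hhu hhv.
  have [q1 e1' h1] := cell_sound hu x0' hhu; have [q2 e2' h2] := cell_sound hv x0' hhv.
  have := q_diff_near h1; have := q_diff_near h2 => /Rabs_le_between h3 /Rabs_le_between h4.
  rewrite fl in e1' e2'; rewrite /W weightS fl /eu /ev e1' e2' /f /ext Rmax_right //.
  by apply/Rabs_le_between; lra.
move=> i t hi ht; have := riemann_error cf p' hW0 hW hi ht.
have -> : RInt f 0 t = (2 ^ m * RInt (fun s => ext (v n) s - ext (u n) s) 0 t)%R.
  exact: (RInt_scal _ 0 t (2 ^ m)%R (ex_RInt_cont 0 t cd)).
move=> /Rabs_le_between h; apply/Rabs_le_between; rewrite /gap; lra.
Qed.

Lemma separated_ineq s cu cv X Y T N i :
  (2 ^ N * X + pos_sum s cu i + neg_sum s cv i + 4 * T.+1 * 2 ^ N <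
   2 ^ N * Y + pos_sum s cv i + neg_sum s cu i) <->
  (4 * (INR T + 1) < INR Y - INR X + / 2 ^ N * weight s cu cv i)%R.
Proof.
have p := pow2_gt0 N.
have e : ((INR Y - INR X + / 2 ^ N * weight s cu cv i) * 2 ^ N =
    2 ^ N * (INR Y - INR X) + weight s cu cv i)%R by field; lra.
have eM : INR (4 * T.+1) = (4 * (INR T + 1))%R by rewrite INR_mul !S_INR /=; ring.
rewrite -eM; move: (4 * T.+1) => M.
split=> [/INR_ltn|] h.
  apply: (Rmult_lt_reg_r (2 ^ N)) => //; rewrite e /weight.
  by move: h; rewrite !INR_add !INR_mul INR_exp2; lra.
apply: ltn_INR; rewrite !INR_add !INR_mul INR_exp2.
by have := Rmult_lt_compat_r _ _ _ p h; rewrite e /weight; lra.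
Qed.

(** The velocities contribute an error of at most [4 * t] and each initial position 2, together
    below the slack [4 * (T + 1)]. The estimate is affine between grid points, so the test at the
    two neighbours of [t] suffices. *)
Lemma separated_sound Mu Mv Mx My u v x0 y0 n T m N t :
  computes_seq Mu u -> computes_seq Mv v -> computes_real Mx x0 -> computes_real My y0 ->
  (0 <= x0)%R -> (0 <= y0)%R ->
  separated (machine_code Mu) (machine_code Mv) (machine_code Mx) (machine_code My)
    n T m N ->
  (0 <= t < INR T)%R -> (0 < gap x0 y0 (u n) (v n) t)%R.
Proof.
move=> hu hv hx hy x00 y00 /and4P [hhx hhy /allP hc /allP hs] [t0 tT].
have hh : cells_halt (machine_code Mu) (machine_code Mv) n m N (T * 2 ^ N).+1.
  by move=> j hj; apply/andP; apply: hc; rewrite mem_iota.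
have p := pow2_gt0 N; have p' := Rinv_0_lt_compat _ p; have pm := pow2_gt0 m.
have [h1 h2] := floor2P N t0; set i := floor2 t N in h1 h2.
have e1 : (/ 2 ^ N * 2 ^ N = 1)%R by apply: Rinv_l; lra.
have hi : i < T * 2 ^ N.
  by apply: ltn_INR; rewrite INR_mul INR_exp2; nra.
have ht : (INR i * / 2 ^ N <= t <= INR i.+1 * / 2 ^ N)%R.
  rewrite S_INR; split; apply: (Rmult_le_reg_r (2 ^ N)) => //; rewrite Rmult_assoc e1; lra.
have := gap_estimate x0 y0 hu hv hh (ltnW hi) ht => /Rabs_le_between.
set W := weight _ _ _ => hg.
have mem k : k <= T * 2 ^ N -> k \in seq.iota 0 (T * 2 ^ N).+1 by rewrite mem_iota.
have /separated_ineq := hs i (mem _ (ltnW hi)); have /separated_ineq := hs i.+1 (mem _ hi).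
rewrite -/W; set Y := q_pos _ _; set X := q_pos _ _ => s2 s1.
have hX := real_run_near hx x00 hhx; have hY := real_run_near hy y00 hhy.
move: hX hY; rewrite -/X -/Y => /Rabs_le_between hX /Rabs_le_between hY.
pose th := ((t - INR i * / 2 ^ N) * 2 ^ N)%R.
have th01 : (0 <= th <= 1)%R.
  rewrite /th Rmult_minus_distr_r Rmult_assoc e1; lra.
have hth : ((t - INR i * / 2 ^ N) * (W i.+1 - W i) =
    th * (/ 2 ^ N * W i.+1 - / 2 ^ N * W i))%R by rewrite /th; field; lra.
rewrite hth in hg; set a := (/ 2 ^ N * W i)%R in hg s1.
set b := (/ 2 ^ N * W i.+1)%R in hg s2.
have hab : (4 * (INR T + 1) - (INR Y - INR X) < a + th * (b - a))%R.
  set c := (_ - _)%R; have ha : (c < a)%R by rewrite /c; lra.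
  have hb : (c < b)%R by rewrite /c; lra.
  by have := Rmult_le_compat_l _ _ _ (proj1 th01) (Rlt_le _ _ hb);
    case: (Rlt_le_dec th 1); nra.
apply: (Rmult_lt_reg_r (2 ^ m)) => //; rewrite Rmult_0_l; lra.
Qed.

Lemma separated_complete Mu Mv Mx My u v x0 y0 n T :
  computes_seq Mu u -> computes_seq Mv v -> computes_real Mx x0 -> computes_real My y0 ->
  (0 <= x0)%R -> (0 <= y0)%R ->
  (forall t, (0 <= t)%R -> (0 < gap x0 y0 (u n) (v n) t)%R) ->
  exists m N,
  separated (machine_code Mu) (machine_code Mv) (machine_code Mx) (machine_code My)
    n T m N.
Proof.
move=> hu hv hx hy x00 y00 hpos.
have cu : forall x, continuous (ext (u n)) x by move=> x; apply: computes_seq_continuous hu.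
have cv : forall x, continuous (ext (v n)) x by move=> x; apply: computes_seq_continuous hv.
have [mx [hmin [mx0 _]]] := continuity_ab_min _ _ _ (pos_INR T)
  (fun c _ => gap_continuous x0 y0 cu cv c).
have ep := hpos mx mx0; set eps := gap _ _ _ _ mx in ep hmin.
(* Half of the 8 pays for the slack in the test, the other half for the errors of the estimate
   itself. *)
have [m hm] : exists m, (8 * (INR T + 1) < eps * 2 ^ m)%R.
  have h2 : (Rabs 2 > 1)%R by rewrite Rabs_pos_eq; lra.
  have [m hm] := Pow_x_infinity 2 h2 (8 * (INR T + 1) / eps + 1)%R.
  exists m; have := hm m (le_n m); rewrite Rabs_pos_eq; last by have := pow2_gt0 m; lra.
  move=> h; apply: (Rmult_lt_reg_r (/ eps)); first exact: Rinv_0_lt_compat.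
  have -> : (eps * 2 ^ m * / eps = 2 ^ m)%R by field; lra.
  lra.
have [N1 h1] := cell_uniform n m (INR T) hu; have [N2 h2] := cell_uniform n m (INR T) hv.
have [N3 h3] := real_run_halts m hx; have [N4 h4] := real_run_halts m hy.
pose N := N1 + N2 + N3 + N4; exists m, N.
have p := pow2_gt0 N; have p' := Rinv_0_lt_compat _ p; have pm := pow2_gt0 m.
have e1 : (/ 2 ^ N * 2 ^ N = 1)%R by apply: Rinv_l; lra.
have grid j : j <= T * 2 ^ N -> (0 <= INR j * / 2 ^ N <= INR T)%R /\
    floor2 (INR j * / 2 ^ N) N = j.
  move=> /INR_leq; rewrite INR_mul INR_exp2 => hj; have j0 := pos_INR j.
  have x0' : (0 <= INR j * / 2 ^ N)%R by nra.
  split.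
    by split=> //; apply: (Rmult_le_reg_r (2 ^ N)) => //; rewrite Rmult_assoc e1; lra.
  by apply: (floor_unique (floor2P N x0')); rewrite Rmult_assoc e1; lra.
have hh : cells_halt (machine_code Mu) (machine_code Mv) n m N (T * 2 ^ N).+1.
  move=> j hj; have [hj1 hj2] := grid j hj.
  by rewrite -hj2; split; [apply: h1 | apply: h2] => //; rewrite /N; lia.
have hhx : halts_code (machine_code Mx) (real_run (machine_code Mx) m N).
  by apply: h3; rewrite /N; lia.
have hhy : halts_code (machine_code My) (real_run (machine_code My) m N).
  by apply: h4; rewrite /N; lia.
have hX := real_run_near hx x00 hhx; have hY := real_run_near hy y00 hhy.
apply/and4P; split=> //; apply/allP => i; rewrite mem_iota add0n => /andP [_ hi].
  exact/andP/hh.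
apply/separated_ineq; set W := weight _ _ _.
have [[g0 gT] _] := grid i hi.
have := hmin _ (conj g0 gT); set t := (INR i * / 2 ^ N)%R in g0 gT * => hgap.
have est : (Rabs (gap x0 y0 (u n) (v n) t * 2 ^ m - ((y0 - x0) * 2 ^ m +
    / 2 ^ N * W i)) <= 4 * t)%R.
  have ht : (t <= t <= INR i.+1 * / 2 ^ N)%R by rewrite /t S_INR; lra.
  have := gap_estimate x0 y0 hu hv hh hi ht; rewrite -/W -/t.
  by rewrite Rminus_diag Rmult_0_l Rplus_0_r.
move/Rabs_le_between: est => est.
move/Rabs_le_between: hX => hX; move/Rabs_le_between: hY => hY.
have : (eps * 2 ^ m <= gap x0 y0 (u n) (v n) t * 2 ^ m)%R by apply: Rmult_le_compat_r; lra.
lra.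
Qed.

Lemma computable_real_computes x : computable_real x -> exists M, computes_real M x.
Proof.
by move=> [phi [M hM hphi] hx]; exists M; split=> //; exists phi.
Qed.

Lemma Pi02_win_set x0 y0 u v : computable_real x0 -> computable_real y0 ->
  (0 < x0)%R -> (x0 < y0)%R ->
  computable_strategies u -> computable_strategies v ->
  Pi02 (evader_win_set x0 y0 u v).
Proof.
move=> /computable_real_computes [Mx hx] /computable_real_computes [My hy] x00 xy.
move=> [Mu hu] [Mv hv].
have y00 : (0 <= y0)%R by lra.
have cu n x : continuous (ext (u n)) x by exact: computes_seq_continuous hu.
have cv n x : continuous (ext (v n)) x by exact: computes_seq_continuous hv.
exists (fun n T b => separated (machine_code Mu) (machine_code Mv) (machine_code Mx)
  (machine_code My) n T (nfst b) (nsnd b)).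
  by apply: prb_computable_rel3; apply: prb_separated; prove_pr.
move=> n; rewrite /evader_win_set evader_winsP //; split=> h.
  move=> T; have [m [N hs]] := separated_complete T hu hv hx hy (Rlt_le _ _ x00) y00 h.
  by exists (npair m N); rewrite nfst_pair nsnd_pair.
move=> t t0; have [T hT] := INR_unbounded t.
have [b hb] := h T.
exact: (separated_sound hu hv hx hy (Rlt_le _ _ x00) y00 hb (conj t0 hT)).
Qed.

(** * Strategies made of bumps *)

(** This is the derivative of [hill], in which the factor 16 makes the maximum, at 1/2, equal to 1.
    As [hill] vanishes at 0 and 1, every excursion returns to the initial position. *)
Definition bump (s : R) : R := (32 * s * (1 - s) * (1 - 2 * s))%R.

Definition hill (s : R) : R := (16 * s ^ 2 * (1 - s) ^ 2)%R.

Definition wave (c : nat -> R) (t : R) : R :=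
  (c (floor2 t 0) * bump (t - INR (floor2 t 0)))%R.

Lemma floor2_0P t : (0 <= t)%R -> (INR (floor2 t 0) <= t < INR (floor2 t 0) + 1)%R.
Proof. by move=> t0; have := floor2P 0 t0; rewrite pow_O Rmult_1_r. Qed.

Lemma floor2_0E a t : (INR a <= t < INR a + 1)%R -> floor2 t 0 = a.
Proof.
move=> ht; have t0 : (0 <= t)%R by have := pos_INR a; lra.
exact: floor_unique (floor2_0P t0) ht.
Qed.

Lemma bump_le s : (0 <= s <= 1)%R -> (Rabs (bump s) <= 8)%R.
Proof.
move=> hs; apply/Rabs_le_between; rewrite /bump.
have h1 : (0 <= s * (1 - s) <= / 4)%R by have := pow2_ge_0 (s - / 2); simpl; nra.
split; nra.
Qed.

Lemma bump_le_ends s : (0 <= s <= 1)%R ->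
  (Rabs (bump s) <= 32 * s /\ Rabs (bump s) <= 32 * (1 - s))%R.
Proof.
move=> hs; have h1 : (Rabs (1 - 2 * s) <= 1)%R by apply/Rabs_le_between; lra.
have hp : (0 <= 32 * (s * (1 - s)))%R by nra.
have -> : (bump s = 32 * (s * (1 - s)) * (1 - 2 * s))%R by rewrite /bump; ring.
rewrite Rabs_mult (Rabs_pos_eq _ hp).
move: (Rabs (1 - 2 * s)) (Rabs_pos (1 - 2 * s)) h1 => r r0 h1.
have := Rmult_le_compat_l _ _ _ hp h1; nra.
Qed.

Lemma bump_lipschitz x y : (0 <= x <= 1)%R -> (0 <= y <= 1)%R ->
  (Rabs (bump x - bump y) <= 32 * Rabs (x - y))%R.
Proof.
move=> hx hy.
(* The divided difference of the cubic, whose first factor stays in [[-1, 1]] on the unit square. *)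
have -> : (bump x - bump y =
    (1 - 3 * (x + y) + 2 * (x * x + x * y + y * y)) * (32 * (x - y)))%R.
  by rewrite /bump; ring.
rewrite Rabs_mult [Rabs (32 * _)]Rabs_mult (Rabs_pos_eq 32); last lra.
rewrite -[X in (_ <= X)%R]Rmult_1_l.
apply: Rmult_le_compat_r; first by have := Rabs_pos (x - y); lra.
have h1 : (0 <= x * (1 - x))%R by nra.
have h2 : (0 <= y * (1 - y))%R by nra.
have h3 := Rle_0_sqr (x - y); have h4 := Rle_0_sqr (x + y - 1).
by apply/Rabs_le_between; rewrite /Rsqr in h3 h4; lra.
Qed.

(** For times in different unit intervals, the vanishing of [bump] at the ends bounds each value by
    [32 * B] times the distance to an integer lying between [s] and [t]; the two distances add up to
    at most [|s - t|]. *)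
Lemma wave_lipschitz c B s t : (forall a, 0 <= c a <= B)%R -> (0 <= s)%R -> (0 <= t)%R ->
  (Rabs (wave c s - wave c t) <= 32 * B * Rabs (s - t))%R.
Proof.
move=> hc; wlog st : s t / (s <= t)%R.
  move=> h s0 t0; have [st|ts] := Rle_lt_dec s t; first exact: h.
  rewrite Rabs_minus_sym (Rabs_minus_sym s).
  by apply: h => //; lra.
move=> s0 t0; rewrite (Rabs_left1 (s - t)); last lra.
have := floor2_0P s0; have := floor2_0P t0; rewrite /wave.
set a := floor2 s 0; set b := floor2 t 0 => hb ha.
have [ha1 ha2] := hc a; have [hb1 hb2] := hc b.
have [ab|ab] := eqVneq a b.
  rewrite -ab in hb *; rewrite -Rmult_minus_distr_l Rabs_mult Rabs_pos_eq //.
  have := @bump_lipschitz (s - INR a) (t - INR a).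
  rewrite (_ : s - INR a - (t - INR a) = s - t)%R; last ring.
  rewrite (Rabs_left1 (s - t)); last lra.
  move=> h; have := h ltac:(lra) ltac:(lra).
  set r := Rabs _ => hr; have : (0 <= r)%R by exact: Rabs_pos.
  nra.
have lt : a < b.
  rewrite ltn_neqAle ab -ltnS; apply: ltn_INR; rewrite S_INR; lra.
have := INR_leq lt; rewrite S_INR => hab.
have [_ h1] := @bump_le_ends (s - INR a) ltac:(lra).
have [h2 _] := @bump_le_ends (t - INR b) ltac:(lra).
apply: Rle_trans (Rabs_triang _ _) _.
rewrite Rabs_Ropp (Rabs_mult (c a)) (Rabs_mult (c b)).
rewrite (Rabs_pos_eq (c a)) // (Rabs_pos_eq (c b)) //.
move: (Rabs (bump (s - INR a))) (Rabs_pos (bump (s - INR a))) h1 => r1 r10 h1.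
move: (Rabs (bump (t - INR b))) (Rabs_pos (bump (t - INR b))) h2 => r2 r20 h2.
have : (c a * r1 <= B * r1)%R by apply: Rmult_le_compat_r.
have : (c b * r2 <= B * r2)%R by apply: Rmult_le_compat_r.
have : (B * (r1 + r2) <= B * (32 * (t - s)))%R by apply: Rmult_le_compat_l; lra.
lra.
Qed.

Lemma hill_bounds s : (0 <= s <= 1)%R -> (0 <= hill s <= 1)%R.
Proof.
move=> hs; have h1 : (0 <= s * (1 - s) <= / 4)%R by have := pow2_ge_0 (s - / 2); simpl; nra.
have -> : (hill s = 16 * (s * (1 - s)) * (s * (1 - s)))%R by rewrite /hill; ring.
nra.
Qed.

Lemma is_RInt_wave_piece c a x : (0 <= x <= 1)%R ->
  is_RInt (wave c) (INR a) (INR a + x) (c a * hill x)%R.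
Proof.
move=> hx; apply: (is_RInt_ext (fun t => c a * bump (t - INR a))%R).
  move=> t; rewrite Rmin_left ?Rmax_right; try lra; move=> ht.
  by rewrite /wave (@floor2_0E a) //; lra.
have -> : (c a * hill x =
    minus (c a * hill (INR a + x - INR a)) (c a * hill (INR a - INR a)))%R.
  by rewrite /minus /plus /opp /= /hill; ring_simplify; ring.
apply: (is_RInt_derive (fun t => c a * hill (t - INR a))%R) => t _.
  by rewrite /hill /bump; auto_derive => //; ring.
apply: (ex_derive_continuous (fun t => c a * bump (t - INR a))%R).
by rewrite /bump; auto_derive.
Qed.

Lemma is_RInt_wave c t : (0 <= t)%R ->
  is_RInt (wave c) 0 t (c (floor2 t 0) * hill (t - INR (floor2 t 0)))%R.
Proof.
move=> t0; set a := floor2 t 0; have := floor2_0P t0; rewrite -/a => ha.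
have h1 : is_RInt (wave c) 0 (INR a) 0%R.
  elim: (a) => [|b IH]; first exact: (@is_RInt_point R_NormedModule).
  have hb := @is_RInt_wave_piece c b 1 ltac:(lra).
  have := is_RInt_Chasles _ _ _ _ _ _ IH hb.
  by rewrite S_INR /plus /= (_ : 0 + c b * hill 1 = 0)%R //; rewrite /hill; ring.
have := is_RInt_Chasles _ _ _ _ _ _ h1 (@is_RInt_wave_piece c a (t - INR a) ltac:(lra)).
by rewrite /plus /= Rplus_0_l (_ : INR a + (t - INR a) = t)%R; last ring.
Qed.

Lemma position_wave x0 c t : (0 <= t)%R ->
  position x0 (wave c) t = (x0 + c (floor2 t 0) * hill (t - INR (floor2 t 0)))%R.
Proof. by move=> t0; rewrite /position (is_RInt_unique _ _ _ _ (@is_RInt_wave c t t0)). Qed.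

(** If [G] is the value of [hill], the distance is [(y0 - x0) * (1 - G) + c a * G]. Both terms are
    nonnegative, and they vanish together only when [G = 1], halfway, and [c a = 0]. *)
Lemma evader_wins_wave x0 y0 (c : nat -> R) : (x0 < y0)%R -> (forall a, 0 <= c a)%R ->
  evader_wins x0 y0 (wave (fun=> (y0 - x0)%R)) (wave c) <-> forall a, (0 < c a)%R.
Proof.
move=> xy hc; split=> h.
  move=> a; case: (Rle_lt_or_eq_dec _ _ (hc a)) => // ca0.
  have t0 : (0 <= INR a + / 2)%R by have := pos_INR a; lra.
  case: (h _ t0); rewrite !position_wave // (@floor2_0E a); last lra.
  rewrite -ca0 (_ : INR a + / 2 - INR a = / 2)%R; last ring.
  by rewrite /hill; field.
move=> t t0; rewrite !position_wave //; have := floor2_0P t0; set a := floor2 _ _ => ha.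
have := @hill_bounds (t - INR a) ltac:(lra); set G := hill _ => hG.
have := h a; have [G1|G1] := Rle_lt_or_eq_dec _ _ (proj2 hG); nra.
Qed.

(** * Strategies of this shape are computable *)

Definition sdyadic (pos : bool) (z i : nat) : Q :=
  Qmake (if pos then Z.of_nat z else - Z.of_nat z)%Z (Pos.of_nat (2 ^ i)).

Definition sdyadic_code (pos : bool) (z i : nat) : nat :=
  npair (if pos then z * 2 else (z * 2).-1) (2 ^ i - 1).

Lemma Qcode_sdyadic pos z i : Qcode (sdyadic pos z i) = sdyadic_code pos z i.
Proof.
have h : 0 < 2 ^ i by rewrite expn_gt0.
rewrite /Qcode /sdyadic_code /npair /= Nat2Pos.id; last by lia.
congr (to_nat (_, _)); last by lia.
by case: pos z => -[|z] //=; rewrite SuccNat2Pos.id_succ muln2.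
Qed.

Lemma Q2R_sdyadic pos z i :
  Q2R (sdyadic pos z i) = ((if pos then INR z else - INR z) / 2 ^ i)%R.
Proof.
have -> : Q2R (sdyadic pos z i) = (if pos then Q2R (dyadic z i) else - Q2R (dyadic z i))%R.
  by case: pos => //; rewrite /Q2R /= opp_IZR; ring.
by rewrite !Q2R_dyadic; case: pos => //; rewrite /Rdiv; ring.
Qed.

(** The sum of the two truncated differences is [|2 ^ K - 2 i|], and the comparison supplies the
    sign. The denominator [2 ^ (4 * K)] is that of the coefficient [C / 2 ^ K] times a cubic in
    [i / 2 ^ K]. *)
Definition bump_code (C i K : nat) : nat :=
  sdyadic_code (i * 2 <= 2 ^ K)
    (32 * C * i * (2 ^ K - i) * ((2 ^ K - i * 2) + (i * 2 - 2 ^ K))) (4 * K).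

Lemma bump_codeE C i K : i <= 2 ^ K -> exists2 q, bump_code C i K = Qcode q &
  Q2R q = (INR C / 2 ^ K * bump (INR i / 2 ^ K))%R.
Proof.
move=> hi; eexists; first by rewrite /bump_code -Qcode_sdyadic; reflexivity.
rewrite Q2R_sdyadic; set D := _ + _; have p := pow2_gt0 K.
have -> : (2 ^ (4 * K) = 2 ^ K * 2 ^ K * 2 ^ K * 2 ^ K)%R.
  by rewrite -!pow_add; congr pow; rewrite !plusE; lia.
have e1 : INR (2 ^ K - i) = (2 ^ K - INR i)%R.
  by rewrite minus_INR ?INR_exp2 //; apply/leP.
have e2 : (if (i * 2 <= 2 ^ K)%N then INR D else - INR D)%R = (2 ^ K - INR i * 2)%R.
  case: ifP => h; rewrite /D.
    have -> : 2 ^ K - i * 2 + (i * 2 - 2 ^ K) = 2 ^ K - i * 2 by lia.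
    by rewrite minus_INR ?INR_exp2 ?INR_mul //; apply/leP.
  have -> : 2 ^ K - i * 2 + (i * 2 - 2 ^ K) = i * 2 - 2 ^ K by lia.
  rewrite minus_INR ?INR_exp2 ?INR_mul /=; [ring | apply/leP; lia].
have -> : (if (i * 2 <= 2 ^ K)%N then INR (32 * C * i * (2 ^ K - i) * D)
    else - INR (32 * C * i * (2 ^ K - i) * D))%R =
    (32 * INR C * INR i * (2 ^ K - INR i) * (2 ^ K - INR i * 2))%R.
  have e3 : INR 32 = 32%R by rewrite INR_IZR_INZ.
  rewrite -e2 -e1 -e3; case: ifP => _; rewrite !INR_mul; ring.
by rewrite /bump; field; lra.
Qed.

Lemma bound_pow_inv k A : (INR A * / 2 ^ (k + A) <= / 2 ^ k)%R.
Proof.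
have pk := pow2_gt0 k; have pA := pow2_gt0 A.
rewrite pow_add Rinv_mult; have ik := Rinv_0_lt_compat _ pk.
have : (INR A * / 2 ^ A <= 1)%R.
  apply: (Rmult_le_reg_r (2 ^ A)) => //; rewrite Rmult_assoc Rinv_l; last lra.
  rewrite -INR_exp2 -[1%R]/(INR 1) -!INR_mul; apply: INR_leq.
  by rewrite muln1 mul1n; apply: ltnW; exact: ltn_expl.
nra.
Qed.

(** [P] certifies that the search has gone far enough for [F] to approximate the coefficient. The
    value returned is that at a dyadic time [x'] close to [x]; the integer parts of the two times
    may differ, and the Lipschitz bound absorbs this. *)
Lemma wave_computable (c : nat -> nat -> R) (B : nat)
    (P : nat -> nat -> nat -> nat -> bool) (F : nat -> nat -> nat -> nat -> nat) :
  (forall t n a k, pr t -> pr n -> pr a -> pr k ->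
    prb (fun e => P (t e) (n e) (a e) (k e))) ->
  (forall t n a k, pr t -> pr n -> pr a -> pr k ->
    pr (fun e => F (t e) (n e) (a e) (k e))) ->
  (forall n a k, exists t, P t n a k) ->
  (forall t n a k, P t n a k -> (Rabs (INR (F t n a k) - c n a * 2 ^ k) <= 4)%R) ->
  (forall n a, (0 <= c n a <= INR B)%R) ->
  computable_strategies (fun n => wave (c n)).
Proof.
(* At working precision [k + A] the error is at most [A] units: [4 * 8] for the coefficient times
   the bound on [bump], and [32 * B * 2] for the rounding of the time. Since [A <= 2 ^ A], this is
   at most [2 ^ -k]. *)
move=> hP hF hex hc hB; pose A := 32 + 64 * B.
pose Z e := q_pos (2 ^ (var 2 e + A)) (ask e (var 2 e + A)).
pose K e := var 2 e + A.
have pK : pr K by rewrite /K; prove_pr.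
have pZ : pr Z by rewrite /Z; prove_pr.
have p2K : pr (fun e => 2 ^ K e) by prove_pr.
have pa := pr_div pZ p2K.
have hPP := hP _ _ _ _ (pr_var 0) (pr_var 1) pa pK.
have pF := hF _ _ _ _ (pr_var 0) (pr_var 1) pa pK.
have hFF : pr (fun e =>
    bump_code (F (var 0 e) (var 1 e) (Z e %/ 2 ^ K e) (K e)) (Z e %% 2 ^ K e) (K e)).
  by rewrite /bump_code /sdyadic_code; prove_pr.
have [M hM] := search_machine 2 hPP hFF.
exists M => n x phi x0 hx k.
have [|T hT hcomp] := hM (fun i => Qcode (phi i)) [:: n; k] erefl.
  by rewrite /Z /K /var /ask /=; exact: hex.
move: hT hcomp; rewrite /Z /K /var /ask /=; set KK := k + A; set z := q_pos _ _.
set a := z %/ 2 ^ KK; set i := z %% 2 ^ KK => hT.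
have hi : i < 2 ^ KK by rewrite ltn_mod expn_gt0.
have [q -> hq] := bump_codeE (F T n a KK) (ltnW hi) => hcomp.
exists q => //; rewrite hq.
have p := pow2_gt0 KK; have ip := Rinv_0_lt_compat _ p.
have hz : (Rabs (INR z - x * 2 ^ KK) <= 2)%R.
  by apply: q_pos_near => //; rewrite Rabs_minus_sym; apply: hx.
pose x' := (INR z / 2 ^ KK)%R.
have x'0 : (0 <= x')%R by have := pos_INR z; rewrite /x' /Rdiv; nra.
have hx' : (x' = INR a + INR i / 2 ^ KK)%R.
  by rewrite /x' (divn_eq z (2 ^ KK)) -/a -/i INR_add INR_mul INR_exp2; field; lra.
have hi' : (0 <= INR i / 2 ^ KK < 1)%R.
  have := pos_INR i; have := INR_ltn hi; rewrite INR_exp2 => h1 h2.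
  split; first by rewrite /Rdiv; nra.
  by apply/Rlt_div_l => //; lra.
have fa : floor2 x' 0 = a by apply: floor2_0E; lra.
have wx' : wave (c n) x' = (c n a * bump (INR i / 2 ^ KK))%R.
  by rewrite /wave fa hx'; congr (_ * bump _)%R; ring.
have lip := wave_lipschitz (hB n) x'0 x0.
have xx' : (Rabs (x' - x) <= 2 * / 2 ^ KK)%R.
  have -> : (x' - x = (INR z - x * 2 ^ KK) * / 2 ^ KK)%R by rewrite /x'; field; lra.
  by rewrite Rabs_mult (Rabs_pos_eq (/ _)); [apply: Rmult_le_compat_r; lra | lra].
have hb := bump_le (conj (proj1 hi') (Rlt_le _ _ (proj2 hi'))).
have err1 : (Rabs (INR (F T n a KK) / 2 ^ KK * bump (INR i / 2 ^ KK) - wave (c n) x')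
    <= 32 * / 2 ^ KK)%R.
  rewrite wx'; set b := bump _ in hb *.
  have -> : (INR (F T n a KK) / 2 ^ KK * b - c n a * b =
      (INR (F T n a KK) - c n a * 2 ^ KK) * (/ 2 ^ KK * b))%R by field; lra.
  rewrite Rabs_mult (Rabs_mult (/ _)) (Rabs_pos_eq (/ _)); last lra.
  have h4 := hc _ _ _ _ hT.
  move: (Rabs (_ - _)) (Rabs_pos (INR (F T n a KK) - c n a * 2 ^ KK)) h4.
  move=> r r0 r4; have b0 := Rabs_pos b.
  have rb : (r * Rabs b <= 32)%R by nra.
  by have := Rmult_le_compat_r _ _ _ (Rlt_le _ _ ip) rb; lra.
have b0 : (0 <= INR B)%R by exact: pos_INR.
have fin : (INR A * / 2 ^ KK <= / 2 ^ k)%R := bound_pow_inv k A.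
have eA : INR A = (32 + 64 * INR B)%R.
  by rewrite /A INR_add INR_mul (INR_IZR_INZ 32) (INR_IZR_INZ 64).
apply: Rle_trans fin; rewrite eA.
rewrite (_ : _ - _ = (INR (F T n a KK) / 2 ^ KK * bump (INR i / 2 ^ KK) - wave (c n) x') +
   (wave (c n) x' - wave (c n) x))%R; last ring.
apply: Rle_trans (Rabs_triang _ _) _.
have : (32 * INR B * Rabs (x' - x) <= 32 * INR B * (2 * / 2 ^ KK))%R.
  by apply: Rmult_le_compat_l; lra.
lra.
Qed.

(** * Hardness *)

(** The value is 0 up to the first success, then 1, and doubles from there on. It approximates the
    amplitude at scale [2 ^ k] by testing [P] below [k] only, without deciding whether a witness
    exists. *)
Definition first_hit (P : nat -> bool) (k : nat) : nat :=
  iteri k (fun s acc => if 0 < acc then acc * 2 else P s) 0.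

(* The real number is [2 ^ -(s + 1)] for the least [s] such that [P s], and 0 if
   there is none. *)
Lemma first_hit_limit (P : nat -> bool) : exists x : R,
  [/\ (0 <= x <= 1)%R, forall k, (Rabs (INR (first_hit P k) - x * 2 ^ k) <= 4)%R &
      (0 < x)%R <-> exists s, P s].
Proof.
case: (classic (exists s, P s)) => [hP|hP]; last first.
  exists 0%R; split; [lra| |by split=> //; lra].
  move=> k; rewrite Rmult_0_l Rminus_0_r; suff -> : first_hit P k = 0.
    by rewrite Rabs_R0; lra.
  elim: k => // k IH; rewrite /first_hit iteriS -/(first_hit P k) IH /=.
  by case hk: (P k) => //; case: hP; exists k.
have [s hs hmin] := ex_minnP hP; have p := pow2_gt0 s.+1; exists (/ 2 ^ s.+1)%R.
have lo k : k <= s -> first_hit P k = 0.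
  elim: k => // k IH hk; rewrite /first_hit iteriS -/(first_hit P k) IH //=;
    last exact: ltnW.
  by case hPk: (P k) => //; have := hmin k hPk; lia.
have hi k : first_hit P (s.+1 + k) = 2 ^ k.
  elim: k => [|k IH]; rewrite ?addn0 ?addnS /first_hit iteriS -/(first_hit P _).
    by rewrite lo //= hs.
  by rewrite IH expn_gt0 /= expnSr.
have x1 : (/ 2 ^ s.+1 <= 1)%R.
  rewrite -Rinv_1; apply: Rinv_le_contravar; first lra.
  by apply: pow_R1_Rle; lra.
have x0 := Rinv_0_lt_compat _ p.
split; [lra| |by split=> // _; exists s].
move=> k; have [ks|sk] := leqP k s.
  rewrite lo // [INR 0]/= Rminus_0_l Rabs_Ropp Rabs_pos_eq; last by have := pow2_gt0 k; nra.
  have hks : (2 ^ k <= 2 ^ s.+1)%R by apply: Rle_pow; [lra | apply/leP; lia].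
  have := Rmult_le_compat_l _ _ _ (Rlt_le _ _ x0) hks; rewrite Rinv_l; lra.
have -> : k = s.+1 + (k - s.+1) by lia.
rewrite hi INR_exp2 pow_add.
have -> : (2 ^ (k - s.+1) - / 2 ^ s.+1 * (2 ^ s.+1 * 2 ^ (k - s.+1)) = 0)%R by field; lra.
rewrite Rabs_R0; lra.
Qed.

(* [e] codes an oracle-free machine and its first argument, and [s] codes its
   third argument and a number of steps. *)
Definition accepts (e a s : nat) : bool :=
  let c := run_code (fun=> 0) (nfst e) (nsnd e) a (nfst s) (nsnd s) in
  halts_code (nfst e) c && (output_code c == 1).

(** All runs of [M] halt, so a witness [b] becomes a witness for [accepts] once it is paired with
    enough steps; conversely, a run that has halted gives the value of [r]. *)
Lemma acceptsP M (r : nat -> nat -> nat -> bool) n a : oracle_free M ->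
  (forall n a b, computes M (fun=> 0) [:: n; a; b] (r n a b)) ->
  (exists s, accepts (npair (machine_code M) n) a s) <-> exists b, r n a b.
Proof.
move=> hM hr; split=> [[s]|[b hb]].
  rewrite /accepts nfst_pair nsnd_pair => /andP [hh].
  rewrite (@free_run_output M _ _ [:: n; a; nfst s] _ _ hM isT (hr _ _ _) hh).
  by case hb: (r _ _ _) => // _; exists (nfst s).
have [t0 h0] := @free_run_halts M (fun=> 0) _ [:: n; a; b] _ hM isT (hr n a b).
exists (npair b t0); rewrite /accepts !nfst_pair !nsnd_pair h0 //=.
by rewrite (@free_run_output M _ _ [:: n; a; b] _ _ hM isT (hr _ _ _) (h0 _ (leqnn _))) hb.
Qed.

Lemma prb_accepts G H K : pr G -> pr H -> pr K ->
  prb (fun e => accepts (G e) (H e) (K e)).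
Proof. by move=> hG hH hK; rewrite /accepts; prove_pr. Qed.

#[local] Hint Resolve prb_accepts : pr.

Lemma Pi02_complete_example x0 y0 : computable_real x0 -> computable_real y0 ->
  (0 < x0)%R -> (x0 < y0)%R -> exists u v : nat -> R -> R,
  computable_strategies u /\ computable_strategies v /\
  Pi02_complete (evader_win_set x0 y0 u v).
Proof.
move=> hx hy x00 xy.
(* The amplitudes are chosen classically; their computability rests on the approximations
   [first_hit] alone. *)
have [c hc] := ClassicalEpsilon.choice _ (fun ea => first_hit_limit (accepts ea.1 ea.2)).
pose u (n : nat) := wave (fun=> (y0 - x0)%R); pose v n := wave (fun a => c (n, a)).
have hu : computable_strategies u.
  have [Mx cx] := computable_real_computes hx; have [My cy] := computable_real_computes hy.
  have [B hB] := INR_unbounded (y0 - x0).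
  apply: (@wave_computable (fun _ _ => y0 - x0)%R B
    (fun t n a k => halts_code (machine_code Mx) (real_run (machine_code Mx) k t) &&
                    halts_code (machine_code My) (real_run (machine_code My) k t))
    (fun t n a k => q_pos (2 ^ k) (output_code (real_run (machine_code My) k t)) -
                    q_pos (2 ^ k) (output_code (real_run (machine_code Mx) k t)))).
  - by move=> *; prove_pr.
  - by move=> *; prove_pr.
  - move=> _ _ k; have [N1 h1] := real_run_halts k cx; have [N2 h2] := real_run_halts k cy.
    by exists (N1 + N2); rewrite h1 ?h2 //; lia.
  - move=> t _ _ k /andP [h1 h2].
    have := real_run_near cx (Rlt_le _ _ x00) h1; have := real_run_near cy _ h2.
    set Y := q_pos _ _; set X := q_pos _ _ => hY hX; have {}hY := hY ltac:(lra).
    move/Rabs_le_between: hX => hX; move/Rabs_le_between: hY => hY.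
    have p : (0 < (y0 - x0) * 2 ^ k)%R by apply: Rmult_lt_0_compat; [lra | exact: pow2_gt0].
    (* If the subtraction is truncated, then [Y <= X] forces [(y0 - x0) * 2 ^ k <= 4], so 0 is still
       accurate enough. *)
    apply/Rabs_le_between; have [le|lt] := leqP Y X.
      have -> : Y - X = 0 by lia.
      by have := INR_leq le; rewrite /=; lra.
    by rewrite minus_INR; [lra | apply/leP; lia].
  - by move=> _ _; lra.
have hv : computable_strategies v.
  apply: (@wave_computable (fun n a => c (n, a)) 1 (fun _ _ _ _ => true)
    (fun _ n a k => first_hit (accepts n a) k)).
  - by move=> *; exact: pr_cst.
  - move=> t n a k _ hn ha hk; apply: pr_iteri => //; first exact: pr_cst.
    by prove_pr.
  - by move=> *; exists 0.
  - by move=> t n a k _; have [_ h _] := hc (n, a).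
  - by move=> n a; have [h _ _] := hc (n, a).
exists u, v; split=> //; split=> //; split; first exact: Pi02_win_set.
(* The strategies are universal: the reduction merely pairs [n] with the fixed code of a machine for
   [r]. *)
move=> S [r [M hM hr] hS]; exists (fun n => npair (machine_code M) n).
  by apply: pr_computable_nat; rewrite /pr1; prove_pr.
move=> n; rewrite hS /evader_win_set evader_wins_wave //; last first.
  by move=> a; have [h _ _] := hc (npair (machine_code M) n, a); lra.
split=> h a; have [_ _ hpos] := hc (npair (machine_code M) n, a).
  by apply/hpos/(acceptsP n a hM hr).
exact/(acceptsP n a hM hr)/hpos.
Qed.

Theorem theorem8 (x0 y0 : R) (hx0 : computable_real x0)
    (hy0 : computable_real y0) (hpos : (0 < x0)%R) (hlt : (x0 < y0)%R) :
  (forall u v : nat -> R -> R,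
     computable_strategies u -> computable_strategies v ->
     Pi02 (evader_win_set x0 y0 u v)) /\
  (exists u v : nat -> R -> R,
     computable_strategies u /\ computable_strategies v /\
     Pi02_complete (evader_win_set x0 y0 u v)).
Proof.
split; first by move=> u v; exact: Pi02_win_set.
exact: Pi02_complete_example.
Qed.
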